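(* Let $\mathfrak{m}\mathrm{LPoset}$ be the linearly compact $\mathbb{Z}[\beta]$-module with pseudobasis the set of isomorphism classes $[(P,\gamma)]$ of (finite) labeled posets. With respect to the continuous linear operations $\nabla,\Delta,\iota,\epsilon$ determined by $$\nabla([(P,\gamma)]\otimes[(Q,\delta)])=[(P,\gamma)\sqcup(Q,\delta)],\qquad \Delta([(P,\gamma)])=\sum_{S\cup T=P}\beta^{|S\cap T|}\,[(S,\gamma)]\otimes[(T,\gamma)],$$ where the second sum is over all ordered pairs $(S,T)$ of subsets of $P$ such that $S$ is a lower set, $T$ is an upper set, $P=S\cup T$, and $S\cap T$ is an antichain, with $\iota(1)=[\varnothing]$ the class of the empty labeled poset, and $\epsilon([(P,\gamma)])=1$ if $P=\varnothing$ and $0$ otherwise, the module $\mathfrak{m}\mathrm{LPoset}$ is a commutative LC-Hopf algebra over $\mathbb{Z}[\beta]$.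
   Context: Labeled posets. A labeled poset $(P,\gamma)$ is a finite poset $P$ with an injective map $\gamma:P\to\mathbb{Z}$. Write $s\lessdot t$ if $t$ covers $s$. $(P,\gamma)\cong(Q,\delta)$ if there is a poset isomorphism $\phi:P\to Q$ such that for every cover $s\lessdot t$ in $P$ one has $\gamma(s)>\gamma(t)$ iff $\delta(\phi(s))>\delta(\phi(t))$; $[(P,\gamma)]$ is the isomorphism class. For $S\subseteq P$, $(S,\gamma)$ means $S$ with the induced order and labeling $\gamma|_S$. The disjoint union $(P,\gamma)\sqcup(Q,\delta)$ is the disjoint union of posets with labeling $s\mapsto\gamma(s)-\max_P\gamma$ for $s\in P$ and $s\mapsto\delta(s)-\min_Q\delta+1$ for $s\in Q$. A lower set (resp. upper set) $S\subseteq P$ is one such that $x<y$ and $y\in S$ (resp. $x\in S$) imply $x\in S$ (resp. $y\in S$). An antichain is a subset containing no two elements $x<y$. Linearly compact modules. Let $R=\mathbb{Z}[\beta]$ (discrete topology). If $A$ is a free $R$-module, $B$ an $R$-module, and $\langle\cdot,\cdot\rangle:A\times B\to R$ is $R$-bilinear with $b\mapsto\langle\cdot,b\rangle$ a bijection $B\to\mathrm{Hom}_R(A,R)$, then $B$ with the coarsest topology making every $\langle a,\cdot\rangle$ continuous is a linearly compact (LC-) module dual to $A$. If $\{a_i\}$ is a basis of $A$, the elements $b_j$ with $\langle a_i,b_j\rangle=\delta_{ij}$ form a pseudobasis of $B$; elements of $B$ are arbitrary (possibly infinite) $R$-linear combinations of the $b_j$. $B\hat\otimes B'=\mathrm{Hom}_R(A\otimes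 A',R)$ is the LC-module with pseudobasis $\{b_i\otimes b'_j\}$. Continuous linear maps are exactly the adjoints of linear maps between the dual free modules. An LC-(co/bi/Hopf) algebra is an LC-module $B$ with continuous linear structure maps ($\nabla:B\hat\otimes B\to B$, $\iota:R\to B$, $\Delta:B\to B\hat\otimes B$, $\epsilon:B\to R$) whose adjoints make the dual free module $A$ an ordinary algebra/coalgebra/bialgebra/Hopf algebra (product of $B$ dual to coproduct of $A$, etc.); the antipode of $B$ is the adjoint of the antipode of $A$. *)

(* Defs.v *)
From HB Require Import structures.
From mathcomp Require Import all_boot all_order all_algebra finmap.
From mathcomp Require Import boolp classical_sets functions topology.
From mathcomp Require Import monalg.

Set Implicit Arguments.
Unset Strict Implicit.
Unset Printing Implicit Defensive.

Import Order.TTheory GRing.Theory Num.Theory.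

Local Open Scope ring_scope.

Record lposet := LPoset {
  lp_disp : Order.disp_t;
  lp_poset :> finPOrderType lp_disp;
  lp_label : lp_poset -> int;
  lp_label_inj : injective lp_label }.

Definition covers (P : lposet) (s t : P) : Prop :=
  (s < t)%O /\ forall u : P, ~ ((s < u)%O /\ (u < t)%O).

Definition lp_iso (P Q : lposet) : Prop :=
  exists phi : P -> Q,
    [/\ bijective phi,
        forall x y : P, (phi x <= phi y)%O = (x <= y)%O
      & forall s t : P, covers s t ->
          (lp_label s > lp_label t) = (lp_label (phi s) > lp_label (phi t))].

Definition lp_empty : lposet :=
  @LPoset _ 'I_0 (fun i => (i : nat)%:Z)
    (fun i _ => match i with Ordinal _ h => match notF h with end end).

Definition lp_sub_carrier (P : lposet) (S : {set P}) : Type :=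
  {x : P | x \in S}.

HB.instance Definition _ (P : lposet) (S : {set P}) :=
  SubFinite.on (lp_sub_carrier S).
HB.instance Definition _ (P : lposet) (S : {set P}) :=
  [SubChoice_isSubPOrder of lp_sub_carrier S by <: with lp_disp P].

Lemma lp_sub_inj (P : lposet) (S : {set P}) :
  injective (fun x : lp_sub_carrier S => lp_label (val x)).
Proof. by move=> x y /lp_label_inj /val_inj. Qed.

Definition lp_sub (P : lposet) (S : {set P}) : lposet :=
  LPoset (@lp_sub_inj P S).

Definition lp_sum_carrier (P Q : lposet) : Type := (P + Q)%type.

HB.instance Definition _ (P Q : lposet) := Finite.on (lp_sum_carrier P Q).

Section Sum.
Variables P Q : lposet.

Definition lp_sum_le : rel (lp_sum_carrier P Q) := fun u v =>
  match u, v with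
  | inl s, inl t => (s <= t)%O
  | inr s, inr t => (s <= t)%O
  | _, _ => false
  end.

Lemma lp_sum_le_refl : reflexive lp_sum_le.
Proof. by case=> s /=. Qed.

Lemma lp_sum_le_anti : antisymmetric lp_sum_le.
Proof. by case=> s [] t //= /le_anti ->. Qed.

Lemma lp_sum_le_trans : transitive lp_sum_le.
Proof. by case=> s [] t [] u //=; apply: le_trans. Qed.

End Sum.

HB.instance Definition _ (P Q : lposet) :=
  Order.Le_isPOrder.Build (lp_disp P) (lp_sum_carrier P Q)
    (@lp_sum_le_refl P Q) (@lp_sum_le_anti P Q) (@lp_sum_le_trans P Q).

(* The maximum (minimum) of the labels of [P]; the element [s] of [P] only
   serves as a starting value, witnessing that [P] is nonempty. *)
Definition lp_max (P : lposet) (s : P) : int :=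
  \big[Order.max/lp_label s]_(x : P) lp_label x.
Definition lp_min (P : lposet) (s : P) : int :=
  \big[Order.min/lp_label s]_(x : P) lp_label x.

Definition lp_sum_label (P Q : lposet) (u : lp_sum_carrier P Q) : int :=
  match u with
  | inl s => lp_label s - lp_max s
  | inr s => lp_label s - lp_min s + 1
  end.

Lemma lp_maxE (P : lposet) (s t : P) : lp_max s = lp_max t.
Proof.
have ub (u x : P) : lp_label x <= lp_max u.
  by rewrite /lp_max; apply: le_bigmax.
by apply/le_anti/andP; split; rewrite {1}/lp_max;
   apply: bigmax_le => [|x _]; apply: ub.
Qed.

Lemma lp_minE (P : lposet) (s t : P) : lp_min s = lp_min t.
Proof.
have lb (u x : P) : lp_min u <= lp_label x.
  by rewrite /lp_min; apply: bigmin_le.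
by apply/le_anti/andP; split; rewrite {2}/lp_min;
   apply: le_bigmin => [|x _]; apply: lb.
Qed.

Lemma lp_sum_label_inj (P Q : lposet) : injective (@lp_sum_label P Q).
Proof.
have lep (s : P) : lp_label s - lp_max s <= 0.
  by rewrite subr_le0; apply: le_bigmax.
have geq (t : Q) : 0 < lp_label t - lp_min t + 1.
  by rewrite ltzD1 subr_ge0; apply: bigmin_le.
case=> s [] t /=.
- by rewrite (lp_maxE s t) => /addIr /lp_label_inj ->.
- by move=> e; have := geq t; rewrite -e ltNge lep.
- by move=> e; have := geq s; rewrite e ltNge lep.
- by rewrite (lp_minE s t) => /addIr /addIr /lp_label_inj ->.
Qed.

Definition lp_sum (P Q : lposet) : lposet := LPoset (@lp_sum_label_inj P Q).

Definition lower_set (P : lposet) (S : {set P}) : bool :=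
  [forall x : P, forall y : P, (x < y)%O && (y \in S) ==> (x \in S)].
Definition upper_set (P : lposet) (S : {set P}) : bool :=
  [forall x : P, forall y : P, (x < y)%O && (x \in S) ==> (y \in S)].
Definition antichain (P : lposet) (S : {set P}) : bool :=
  [forall x : P, forall y : P, (x \in S) && (y \in S) ==> ~~ (x < y)%O].

(* [lposet] quantifies over all finite types, so it is too large to be a
   [choiceType]. An isomorphism class is therefore represented by the set of
   its members with carrier ['I_n], each given by its order and labeling;
   [lp_class_eq] and [lp_class_surj] show that this is faithful. *)
Definition ord_lposet : Type :=
  {n : nat & (rel 'I_n * ('I_n -> int))%type}.

Definition ord_lposet_of (c : ord_lposet) (P : lposet) : Prop :=
  exists f : 'I_(tag c) -> P,
    [/\ bijective f,
        forall i j, (tagged c).1 i j = (f i <= f j)%O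
      & forall i, (tagged c).2 i = lp_label (f i)].

Definition lp_members (P : lposet) : set ord_lposet :=
  [set c | exists2 Q : lposet, lp_iso P Q & ord_lposet_of c Q]%classic.

Record lpclass := LPClass {
  lpclass_set : set ord_lposet;
  lpclassP : exists P : lposet, lpclass_set = lp_members P }.

HB.instance Definition _ := gen_eqMixin lpclass.
HB.instance Definition _ := gen_choiceMixin lpclass.

Definition lp_class (P : lposet) : lpclass :=
  LPClass (ex_intro _ P erefl).

Lemma lp_iso_covers (P Q : lposet) (phi : P -> Q) :
    bijective phi -> (forall x y : P, (phi x <= phi y)%O = (x <= y)%O) ->
  forall s t : P, covers (phi s) (phi t) <-> covers s t.
Proof.
move=> [psi phiK psiK] phi_mono.
have phi_lt (x y : P) : (phi x < phi y)%O = (x < y)%O.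
  by rewrite !lt_def phi_mono (can_eq phiK).
move=> s t; split=> -[lt_st nb]; split; rewrite ?phi_lt // in lt_st *.
  by move=> u; rewrite -!phi_lt; apply: nb.
by move=> u; rewrite -[u]psiK !phi_lt; apply: nb.
Qed.

Lemma lp_iso_refl (P : lposet) : lp_iso P P.
Proof. by exists id; split=> //; exists id. Qed.

Lemma lp_iso_sym (P Q : lposet) : lp_iso P Q -> lp_iso Q P.
Proof.
move=> [phi [phi_bij phi_mono phi_lab]].
have [psi phiK psiK] := phi_bij.
exists psi; split=> [|x y|s t cov]; first by exists phi.
  by rewrite -phi_mono !psiK.
rewrite phi_lab ?psiK //.
by apply/(lp_iso_covers phi_bij phi_mono); rewrite !psiK.
Qed.

Lemma lp_iso_trans (P Q S : lposet) : lp_iso P Q -> lp_iso Q S -> lp_iso P S.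
Proof.
move=> [f [f_bij f_mono f_lab]] [g [g_bij g_mono g_lab]].
exists (g \o f); split=> [|x y|s t cov] /=; first exact: bij_comp.
  by rewrite g_mono f_mono.
rewrite f_lab // g_lab //.
exact/(lp_iso_covers f_bij f_mono).
Qed.

Lemma ord_lposet_ex (P : lposet) : exists c, ord_lposet_of c P.
Proof.
exists (existT _ #|P| ((fun i j => (enum_val i <= enum_val j :> P)%O),
                       (fun i => lp_label (enum_val i : P)))).
exists (fun i => enum_val i); split=> //.
Qed.

Lemma ord_lposet_iso c (P Q : lposet) :
  ord_lposet_of c P -> ord_lposet_of c Q -> lp_iso P Q.
Proof.
move=> [f [[f' fK f'K] f_le f_lab]] [g [g_bij g_le g_lab]].
exists (g \o f'); split=> [|x y|s t _] /=.
- by apply: bij_comp => //; exists f.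
- by rewrite -g_le f_le !f'K.
- by rewrite -!g_lab !f_lab !f'K.
Qed.

Lemma lp_class_eq (P Q : lposet) : lp_class P = lp_class Q <-> lp_iso P Q.
Proof.
split=> [[ePQ]|PQ].
  have [c cP] := ord_lposet_ex P.
  have : lp_members P c by exists P => //; apply: lp_iso_refl.
  rewrite ePQ => -[S QS cS].
  exact: lp_iso_trans (ord_lposet_iso cP cS) (lp_iso_sym QS).
have eM : lp_members P = lp_members Q.
  apply/seteqP; split=> c [S PS cS]; exists S => //.
    exact: lp_iso_trans (lp_iso_sym PQ) PS.
  exact: lp_iso_trans PQ PS.
rewrite /lp_class; move: (ex_intro _ P _) (ex_intro _ Q _).
by rewrite eM => p q; congr LPClass; apply: Prop_irrelevance.
Qed.

Lemma lp_class_surj (c : lpclass) : exists P : lposet, lp_class P = c.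
Proof.
case: c => X XP; have [P eX] := XP; exists P.
by subst X; congr LPClass; apply: Prop_irrelevance.
Qed.

(* [{malg R[I]}] is the free [R]-module with basis [I], the basis element
   attached to [i] being [<< i >>], and [{malg R[I]} ⊗ {malg R[J]}] is
   [{malg R[I * J]}]. *)
Section FreeModules.
Variable R : comNzRingType.

Definition lin_ext (I : choiceType) (V : lmodType R) (f : I -> V)
    (a : {malg R[I]}) : V :=
  \sum_(i <- msupp a) a@_i *: f i.

Definition tens (I J : choiceType) (a : {malg R[I]}) (b : {malg R[J]}) :
    {malg R[(I * J)%type]} :=
  lin_ext (fun i => lin_ext (fun j => << (i, j) >>) b) a.

Definition tens_map (I J I' J' : choiceType)
    (f : {malg R[I]} -> {malg R[I']}) (g : {malg R[J]} -> {malg R[J']}) :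
    {malg R[(I * J)%type]} -> {malg R[(I' * J')%type]} :=
  lin_ext (fun p => tens (f << p.1 >>) (g << p.2 >>)).

Definition tens_assoc (I J K : choiceType) :
    {malg R[(I * J * K)%type]} -> {malg R[(I * (J * K))%type]} :=
  lin_ext (fun p => << (p.1.1, (p.1.2, p.2)) >>).

(* [id ⊗ swap ⊗ id] *)
Definition tens_swap_mid (I : choiceType) :
    {malg R[((I * I) * (I * I))%type]} -> {malg R[((I * I) * (I * I))%type]} :=
  lin_ext (fun p => << ((p.1.1, p.2.1), (p.1.2, p.2.2)) >>).

(* [f ⊗ id] and [id ⊗ f] for a linear form [f], where [R ⊗ A] and [A ⊗ R]
   are identified with [A]. *)
Definition form_tens_id (I J : choiceType) (f : {malg R[I]} -> R) :
    {malg R[(I * J)%type]} -> {malg R[J]} :=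
  lin_ext (fun p => f << p.1 >> *: << p.2 >>).
Definition id_tens_form (I J : choiceType) (f : {malg R[J]} -> R) :
    {malg R[(I * J)%type]} -> {malg R[I]} :=
  lin_ext (fun p => f << p.2 >> *: << p.1 >>).

Section Structures.
Variable I : choiceType.
Local Notation A := {malg R[I]}.
Local Notation AA := {malg R[(I * I)%type]}.
Variables (mul : AA -> A) (eta : R -> A) (com : A -> AA) (cou : A -> R).

Definition is_algebra : Prop :=
  [/\ linear mul,
      linear (eta : R^o -> A),
      forall a b c : A,
        mul (tens (mul (tens a b)) c) = mul (tens a (mul (tens b c))),
      forall a : A, mul (tens (eta 1) a) = a
    & forall a : A, mul (tens a (eta 1)) = a].

Definition is_coalgebra : Prop :=
  [/\ linear com,
      linear (cou : A -> R^o),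
      forall a : A,
        tens_assoc (tens_map com id (com a)) = tens_map id com (com a),
      forall a : A, form_tens_id cou (com a) = a
    & forall a : A, id_tens_form cou (com a) = a].

Definition is_bialgebra : Prop :=
  [/\ is_algebra,
      is_coalgebra,
      (forall a b : A, com (mul (tens a b)) =
         tens_map mul mul (tens_swap_mid (tens (com a) (com b)))) /\
      com (eta 1) = tens (eta 1) (eta 1)
    & (forall a b : A, cou (mul (tens a b)) = cou a * cou b) /\
      cou (eta 1) = 1].

Definition is_antipode (S : A -> A) : Prop :=
  [/\ linear S,
      forall a : A, mul (tens_map S id (com a)) = eta (cou a)
    & forall a : A, mul (tens_map id S (com a)) = eta (cou a)].

Definition is_hopf : Prop := is_bialgebra /\ exists S, is_antipode S.

End Structures.
End FreeModules.

(* The LC-module with pseudobasis [I], dual to [{malg R[I]}]: its elements are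
   the arbitrary formal combinations of the elements of [I]. The completed
   tensor product of [lc R I] and [lc R J] is [lc R (I * J)]. *)
Definition lc (R : comNzRingType) (I : choiceType) : Type := I -> R^o.

HB.instance Definition _ (R : comNzRingType) (I : choiceType) :=
  GRing.Lmodule.on (lc R I).

Section LC.
Variable R : comNzRingType.

Definition pairing (I : choiceType) (a : {malg R[I]}) (b : lc R I) : R :=
  \sum_(i <- msupp a) a@_i * b i.

(* The coarsest topology making every [pairing a] continuous, [R] being
   discrete. *)
HB.instance Definition _ (I : choiceType) := Topological.copy (lc R I)
  (sup_topology (fun a : {malg R[I]} =>
     Topological.class
       (initial_topology (pairing a : lc R I -> discrete_topology R)))).

Definition lc_basis (I : choiceType) (i : I) : lc R I := fun j => (j == i)%:R.

Definition lc_tens (I J : choiceType) (b : lc R I) (b' : lc R J) :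
    lc R (I * J)%type :=
  fun p => b p.1 * b' p.2.

Definition lc_swap (I J : choiceType) (b : lc R (I * J)%type) :
    lc R (J * I)%type :=
  fun p => b (p.2, p.1).

Lemma pairing_basis (I : choiceType) (i j : I) :
  pairing << i >> (lc_basis j) = (i == j)%:R.
Proof. by rewrite /pairing msuppU oner_eq0 big_seq_fset1 mcoeffUU mul1r. Qed.

Lemma pairing_perfect (I : choiceType) (f : {malg R[I]} -> R) :
    linear (f : _ -> R^o) ->
  exists! b : lc R I, forall a, pairing a b = f a.
Proof.
move=> f_lin.
pose F : {linear {malg R[I]} -> R^o} :=
  HB.pack (f : _ -> R^o) (GRing.isLinear.Build _ _ _ _ (f : _ -> R^o) f_lin).
exists (fun i => f << i >>); split=> [a|b fb].
  rewrite -[f]/(F : _ -> _) {2}[a]monalgE raddf_sum /=; apply: eq_bigr => i _.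
  have -> : << a@_i *g i >> = a@_i *: << i >> :> {malg R[I]}.
    by apply/malgP=> k; rewrite mcoeffZ !mcoeffU mulr_natr.
  exact: esym (linearZZ F _ _).
apply/funext=> i; rewrite -fb /pairing msuppU oner_eq0 big_seq_fset1.
by rewrite mcoeffUU mul1r.
Qed.

Definition adjoint (I J : choiceType) (f : lc R I -> lc R J)
    (g : {malg R[J]} -> {malg R[I]}) : Prop :=
  forall a b, pairing a (f b) = pairing (g a) b.

(* [R] itself is the LC-module dual to [R] under multiplication. *)
Definition adjoint_from_scalars (I : choiceType) (f : R -> lc R I)
    (g : {malg R[I]} -> R) : Prop :=
  forall a r, pairing a (f r) = g a * r.
Definition adjoint_to_scalars (I : choiceType) (f : lc R I -> R)
    (g : R -> {malg R[I]}) : Prop :=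
  forall r b, r * f b = pairing (g r) b.

Definition lc_map (I J : choiceType) (f : lc R I -> lc R J) : Prop :=
  linear f /\ continuous f.
Definition lc_map_from_scalars (I : choiceType) (f : R -> lc R I) : Prop :=
  linear (f : R^o -> lc R I) /\ continuous (f : discrete_topology R -> lc R I).
Definition lc_map_to_scalars (I : choiceType) (f : lc R I -> R) : Prop :=
  linear (f : lc R I -> R^o) /\ continuous (f : lc R I -> discrete_topology R).

Section Hopf.
Variable I : choiceType.
Variables (nabla : lc R (I * I)%type -> lc R I) (iota : R -> lc R I).
Variables (delta : lc R I -> lc R (I * I)%type) (eps : lc R I -> R).

Definition is_lc_hopf : Prop :=
  [/\ lc_map nabla, lc_map_from_scalars iota, lc_map delta
    & lc_map_to_scalars eps] /\
  exists (mul : {malg R[(I * I)%type]} -> {malg R[I]}) (eta : R -> {malg R[I]})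
         (com : {malg R[I]} -> {malg R[(I * I)%type]}) (cou : {malg R[I]} -> R),
    [/\ adjoint delta mul, adjoint_to_scalars eps eta,
        adjoint nabla com & adjoint_from_scalars iota cou] /\
    is_hopf mul eta com cou.

Definition lc_commutative : Prop := forall b, nabla (lc_swap b) = nabla b.

End Hopf.
End LC.

Notation Zbeta := {poly int}.
Notation beta := ('X : {poly int}).

Definition mLPoset : Type := lc Zbeta lpclass.
Definition mLPoset2 : Type := lc Zbeta (lpclass * lpclass)%type.

Definition lp_basis (P : lposet) : mLPoset := lc_basis Zbeta (lp_class P).

Definition is_nabla (nabla : mLPoset2 -> mLPoset) : Prop :=
  lc_map nabla /\
  forall P Q : lposet,
    nabla (lc_tens (lp_basis P) (lp_basis Q)) = lp_basis (lp_sum P Q).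

Definition is_delta (delta : mLPoset -> mLPoset2) : Prop :=
  lc_map delta /\
  forall P : lposet,
    delta (lp_basis P) =
    \sum_(ST : {set P} * {set P} |
            [&& lower_set ST.1, upper_set ST.2, ST.1 :|: ST.2 == [set: P]
              & antichain (ST.1 :&: ST.2)])
      beta ^+ #|ST.1 :&: ST.2| *:
        lc_tens (lp_basis (lp_sub ST.1)) (lp_basis (lp_sub ST.2)).

Definition is_iota (iota : Zbeta -> mLPoset) : Prop :=
  lc_map_from_scalars iota /\ iota 1 = lp_basis lp_empty.

Definition is_eps (eps : mLPoset -> Zbeta) : Prop :=
  lc_map_to_scalars eps /\
  forall P : lposet, eps (lp_basis P) = if #|P| == 0%N then 1 else 0.

(* Main.v *)
From HB Require Import structures.
Require Import Defs.
From mathcomp Require Import all_boot all_order all_algebra finmap.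
From mathcomp Require Import boolp classical_sets functions topology.
From mathcomp Require Import monalg.
From mathcomp Require Import finset zify.

(* The continuous linear maps between the LC-modules are the adjoints of the
   linear maps between the free modules, so everything is checked on the free
   module [A] with basis the isomorphism classes, read as finitely supported
   functions [a] of classes. There the coproduct is [com a (P, Q) = a (P + Q)],
   and the product of [a] and [b] has value
   [sum_(S, T) beta^|S & T| a(S) b(T)] at [P]. These sums define elements of [A]
   and continuous maps because there are finitely many classes of each size.
   Coassociativity of Delta, the only combinatorial point, holds because
   ((A | B), C) and (A, B) are admissible for P and A | B exactly when
   (A, (B | C)) and (B, C) are admissible for P and B | C, and both
   sides carry the exponent |A & B| + |A & C| + |B & C| - |A & B & C|.
   The coproduct of [A] preserves sizes and the empty poset is the only class of
   size 0, so [id - eta cou] is locally nilpotent for convolution and [id] is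
   invertible by the geometric series. *)

Set Implicit Arguments.
Unset Strict Implicit.
Unset Printing Implicit Defensive.

Import Order.TTheory GRing.Theory Num.Theory.

Local Open Scope ring_scope.

(** * Linear algebra of free modules and the antipode *)

Section LinExt.
Variables (R : comNzRingType) (I : choiceType).

Lemma monalgUZ c (i : I) : << c *g i >> = c *: << i >> :> {malg R[I]}.
Proof. by apply/malgP=> k; rewrite mcoeffZ !mcoeffU mulr_natr. Qed.

Section Target.
Variable V : lmodType R.

Lemma lin_extEw (f : I -> V) (a : {malg R[I]}) (d : {fset I}) :
  (msupp a `<=` d)%fset -> lin_ext f a = \sum_(i <- d) a@_i *: f i.
Proof.
move=> le_ad; rewrite /lin_ext (big_fset_incl _ le_ad) // => i _ /mcoeff_outdom->.
by rewrite scale0r.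
Qed.

Lemma lin_ext_linear (f : I -> V) : linear (lin_ext f).
Proof.
move=> c a b; pose d := (msupp a `|` msupp b `|` msupp (c *: a + b))%fset.
have sa : (msupp a `<=` d)%fset by rewrite /d -fsetUA fsubsetUl.
have sb : (msupp b `<=` d)%fset by rewrite /d fsetUAC fsubsetUr.
have sc : (msupp (c *: a + b) `<=` d)%fset by rewrite fsubsetUr.
rewrite !(lin_extEw _ sa, lin_extEw _ sb, lin_extEw _ sc) scaler_sumr -big_split.
by apply: eq_bigr => i _; rewrite mcoeffD mcoeffZ scalerDl scalerA.
Qed.

HB.instance Definition _ (f : I -> V) :=
  GRing.isLinear.Build R {malg R[I]} V _ (lin_ext f) (lin_ext_linear f).

Lemma lin_extU (f : I -> V) i : lin_ext f << i >> = f i.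
Proof. by rewrite /lin_ext msuppU oner_eq0 big_seq_fset1 mcoeffUU scale1r. Qed.

Lemma linear_lin_ext (W : lmodType R) (h : V -> W) (f : I -> V) a :
  linear h -> h (lin_ext f a) = lin_ext (h \o f) a.
Proof.
move=> h_lin.
pose H : {linear V -> W} := HB.pack h (GRing.isLinear.Build _ _ _ _ h h_lin).
rewrite -[h]/(H : _ -> _) /lin_ext linear_sum; apply: eq_bigr => i _.
exact: linearZ.
Qed.

Lemma lin_ext_id (a : {malg R[I]}) : lin_ext (fun i => << i >>) a = a.
Proof.
by rewrite [RHS]monalgE; apply: eq_bigr => i _; rewrite -monalgUZ.
Qed.

End Target.

Lemma linear_malgE (V : lmodType R) (f : {malg R[I]} -> V) a :
  linear f -> f a = lin_ext (fun i => f << i >>) a.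
Proof. by move=> f_lin; rewrite -{1}[a]lin_ext_id (linear_lin_ext _ _ f_lin). Qed.

Lemma eq_lin_ext (V : lmodType R) (f g : I -> V) a :
  {in msupp a, f =1 g} -> lin_ext f a = lin_ext g a.
Proof. by move=> fg; apply: eq_big_seq => i /fg ->. Qed.

Lemma linear_malg_eq (V : lmodType R) (f g : {malg R[I]} -> V) :
  linear f -> linear g -> (forall i, f << i >> = g << i >>) -> f =1 g.
Proof.
move=> fl gl fg a; rewrite (linear_malgE a fl) (linear_malgE a gl).
by apply: eq_lin_ext => i _; apply: fg.
Qed.

(** The algebraic axioms speak of bare functions with a proof of linearity, so the usual rules are
    restated for such functions. *)
Lemma linear_sumE (V W : lmodType R) (h : V -> W) (J : Type) (r : seq J)
    (P : pred J) (c : J -> R) (F : J -> V) : linear h ->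
  h (\sum_(j <- r | P j) c j *: F j) = \sum_(j <- r | P j) c j *: h (F j).
Proof.
move=> h_lin.
pose H : {linear V -> W} := HB.pack h (GRing.isLinear.Build _ _ _ _ h h_lin).
rewrite -[h]/(H : _ -> _) linear_sum; apply: eq_bigr => i _; exact: linearZ.
Qed.

Lemma linearZE (V W : lmodType R) (h : V -> W) c a :
  linear h -> h (c *: a) = c *: h a.
Proof.
move=> h_lin.
pose H : {linear V -> W} := HB.pack h (GRing.isLinear.Build _ _ _ _ h h_lin).
exact: (linearZ_LR H).
Qed.

Lemma linearDE (V W : lmodType R) (h : V -> W) a b :
  linear h -> h (a + b) = h a + h b.
Proof. by move=> h_lin; rewrite -[a]scale1r h_lin !scale1r. Qed.

Lemma linear0E (V W : lmodType R) (h : V -> W) : linear h -> h 0 = 0.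
Proof. by move=> h_lin; have := linearZE 0 0 h_lin; rewrite !scale0r. Qed.

Lemma linear_comp (U V W : lmodType R) (g : V -> W) (f : U -> V) :
  linear g -> linear f -> linear (fun x => g (f x)).
Proof. by move=> gl fl c x y; rewrite fl gl. Qed.

End LinExt.

Section Tens.
Variable R : comNzRingType.
Implicit Types I J K : choiceType.

(** Exchanging the two finite sums gives linearity in the second factor from linearity of
    [lin_ext]. *)
Lemma tensC I J (a : {malg R[I]}) (b : {malg R[J]}) :
  tens a b = lin_ext (fun j => lin_ext (fun i => << (i, j) >>) a) b.
Proof.
rewrite /tens /lin_ext; under eq_bigr do rewrite scaler_sumr.
rewrite exchange_big; apply: eq_bigr => j _; rewrite scaler_sumr.
by apply: eq_bigr => i _; rewrite !scalerA mulrC.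
Qed.

Lemma tens_linearl I J (b : {malg R[J]}) :
  linear (fun a : {malg R[I]} => tens a b).
Proof. exact: lin_ext_linear. Qed.

Lemma tens_linearr I J (a : {malg R[I]}) :
  linear (fun b : {malg R[J]} => tens a b).
Proof. by move=> c x y; rewrite !tensC linearP. Qed.

Lemma tensUU I J (i : I) (j : J) : tens << i >> << j >> = << (i, j) >> :> {malg R[_]}.
Proof. by rewrite /tens !lin_extU. Qed.

Lemma tens_coeff I J (a : {malg R[I]}) (b : {malg R[J]}) i j :
  (tens a b)@_(i, j) = a@_i * b@_j.
Proof.
have mcl K (k : K) : linear (mcoeff k : {malg R[K]} -> R^o).
  by move=> c x y; rewrite mcoeffD mcoeffZ.
(* Both sides are bilinear in [a] and [b], so it suffices to compare them on basis elements. *)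
pose f a : {malg R[J]} -> R^o := fun b => (tens a b)@_(i, j).
pose g a : {malg R[J]} -> R^o := fun b => (a : {malg R[I]})@_i * b@_j.
rewrite -[LHS]/(f a b) -[RHS]/(g a b).
apply: (@linear_malg_eq _ _ _ (f ^~ b) (g ^~ b)) => {a}.
- exact: (linear_comp (mcl _ _) (tens_linearl _)).
- by move=> c x y; rewrite /g mcoeffD mcoeffZ mulrDl -mulrA.
move=> i'; apply: linear_malg_eq => {b}.
- exact: (linear_comp (mcl _ _) (tens_linearr _)).
- by move=> c x y; rewrite /g mcoeffD mcoeffZ mulrDr mulrCA.
by move=> j'; rewrite /f /g tensUU !mcoeffU xpair_eqE -natrM mulnb.
Qed.

End Tens.

(** * Convolution and the antipode of a connected bialgebra *)

Section Antipode.
Variables (R : comNzRingType) (I : choiceType).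
Local Notation A := {malg R[I]}.
Local Notation AA := {malg R[(I * I)%type]}.
Variables (mul : AA -> A) (eta : R -> A) (com : A -> AA) (cou : A -> R).
Hypotheses (algA : is_algebra mul eta) (coalgA : is_coalgebra com cou).

Let mul_linear : linear mul. Proof. by case: algA. Qed.
Let com_linear : linear com. Proof. by case: coalgA. Qed.

(* Convolution of the linear endomorphisms with values [f] and [g] on the
   basis, again given by its values on the basis. *)
Definition conv (f g : I -> A) (i : I) : A :=
  lin_ext (fun p : I * I => mul (tens (f p.1) (g p.2))) (com << i >>).

(** The composite of unit and counit, which is neutral for convolution. *)
Definition conv1 (i : I) : A := cou << i >> *: eta 1.

Let mult_linearl b : linear (fun a => mul (tens a b)).
Proof. exact: (linear_comp mul_linear (tens_linearl _)). Qed.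
Let mult_linearr a : linear (fun b => mul (tens a b)).
Proof. exact: (linear_comp mul_linear (tens_linearr _)). Qed.

Lemma conv1l f : conv conv1 f =1 f.
Proof.
move=> i; case: algA => _ _ _ mul1a _; case: coalgA => _ _ _ cou1 _.
rewrite -[RHS](lin_extU f) -(cou1 << i >>) (linear_lin_ext _ _ (lin_ext_linear _)).
apply: eq_lin_ext => p _ /=; rewrite linearZ_LR /= lin_extU.
by rewrite (linearZE _ _ (mult_linearl _)) mul1a.
Qed.

Lemma conv1r f : conv f conv1 =1 f.
Proof.
move=> i; case: algA => _ _ _ _ mula1; case: coalgA => _ _ _ _ cou1.
rewrite -[RHS](lin_extU f) -(cou1 << i >>) (linear_lin_ext _ _ (lin_ext_linear _)).
apply: eq_lin_ext => p _ /=; rewrite linearZ_LR /= lin_extU.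
by rewrite (linearZE _ _ (mult_linearr _)) mula1.
Qed.

Lemma eq_conv f f' g g' : f =1 f' -> g =1 g' -> conv f g =1 conv f' g'.
Proof. by move=> ff gg i; apply: eq_lin_ext => p _; rewrite ff gg. Qed.

(** Both sides evaluate a threefold product on an iterated coproduct. Associativity of [mul]
    identifies the products [F] and [G], coassociativity of [com] the coproducts. *)
Lemma convA f g h : conv (conv f g) h =1 conv f (conv g h).
Proof.
move=> i; case: algA => _ _ mulA _ _; case: coalgA => _ _ comA _ _.
pose F (p : I * I * I) := mul (tens (mul (tens (f p.1.1) (g p.1.2))) (h p.2)).
pose G (p : I * (I * I)) := mul (tens (f p.1) (mul (tens (g p.2.1) (h p.2.2)))).
have eF x : lin_ext F x = lin_ext G (tens_assoc x).
  rewrite (linear_lin_ext _ _ (lin_ext_linear _)); apply: eq_lin_ext => p _ /=.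
  by rewrite lin_extU /F mulA.
have -> : conv (conv f g) h i = lin_ext F (tens_map com id (com << i >>)).
  rewrite (linear_lin_ext _ _ (lin_ext_linear _)); apply: eq_lin_ext => -[p q] _ /=.
  (* The inner coproduct enters linearly, so it may be replaced by a basis element. *)
  rewrite /conv; move: (com _) => y; move: y.
  apply: linear_malg_eq => [||y].
  - exact: (linear_comp (mult_linearl _) (lin_ext_linear _)).
  - exact: (linear_comp (lin_ext_linear _) (tens_linearl _)).
  rewrite (tensUU _ y q) (lin_extU F) /F /=.
  by congr (mul (tens _ _)); apply: lin_extU.
rewrite eF comA (linear_lin_ext _ _ (lin_ext_linear _)).
apply: eq_lin_ext => -[p q] _ /=; rewrite /conv; move: (com _) => y; move: y.
apply: linear_malg_eq => [||y].
- exact: (linear_comp (lin_ext_linear _) (tens_linearr _)).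
- exact: (linear_comp (mult_linearr _) (lin_ext_linear _)).
by rewrite tensUU (lin_extU G) lin_extU.
Qed.

(** Connectedness: the unit is the only possible basis element of size 0, and the coproduct does not
    increase total size. *)
Variables (sz : I -> nat) (i0 : I).
Hypotheses (sz_eq0 : forall i, sz i = 0%N -> i = i0) (eta1 : eta 1 = << i0 >>)
  (cou_i0 : cou << i0 >> = 1)
  (sz_com : forall i p, p \in msupp (com << i >>) -> (sz p.1 + sz p.2 <= sz i)%N).

(** The endomorphism [id - eta cou]; it vanishes at [i0], the source of its local nilpotency. *)
Definition reduced (i : I) : A := << i >> - conv1 i.

Definition reduced_pow (k : nat) : I -> A := iter k (conv reduced) conv1.

(** The powers are built by convolving on the left; the left inverse needs the new factor on the
    right. *)
Lemma reduced_powSr k : reduced_pow k.+1 =1 conv (reduced_pow k) reduced.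
Proof.
elim: k => [|k IHk] i; first exact: etrans (conv1r _ _) (esym (conv1l _ _)).
rewrite convA; apply: eq_conv IHk i => j; exact: erefl.
Qed.

(** In each term of the coproduct, either the first factor has size 0 and [reduced] kills it, or it
    has positive size and the second factor is too small for the remaining power. *)
Lemma reduced_pow_eq0 k i : (sz i < k)%N -> reduced_pow k i = 0.
Proof.
elim: k i => // k IHk i lt_i_k.
rewrite [LHS]/= /conv /lin_ext big_seq big1 // => p /sz_com le_p.
suff -> : mul (tens (reduced p.1) (reduced_pow k p.2)) = 0 by exact: scaler0.
have [p0|p_gt0] := posnP (sz p.1).
  rewrite (sz_eq0 p0) /reduced /conv1 cou_i0 scale1r eta1 subrr.
  exact: linear0E (mult_linearl _).
rewrite IHk; last by lia.
exact: linear0E (mult_linearr _).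
Qed.

(** The geometric series inverting [conv1 + reduced], stopped at [k = sz i], beyond which the powers
    vanish at [i]. *)
Definition antipode_basis (i : I) : A :=
  \sum_(k < (sz i).+1) (-1) ^+ k *: reduced_pow k i.

(** A longer sum only adds zero terms, so all factors of one coproduct can share a cutoff. *)
Lemma antipode_basisE N i : (sz i <= N)%N ->
  antipode_basis i = \sum_(k < N.+1) (-1) ^+ k *: reduced_pow k i.
Proof.
move=> leN; rewrite [LHS](big_ord_widen N.+1 (fun k : nat => (-1) ^+ k *: reduced_pow k i)) //.
rewrite [LHS]big_mkcond; apply: eq_bigr => k _; rewrite ltnS; case: leqP => [//|lt_k].
by rewrite (reduced_pow_eq0 lt_k) scaler0.
Qed.

Lemma telescope_antipode N i : (sz i <= N)%N ->
  \sum_(k < N.+1) (-1) ^+ k *: (reduced_pow k i + reduced_pow k.+1 i) = conv1 i.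
Proof.
move=> leN; suff -> n : \sum_(k < n) (-1) ^+ k *: (reduced_pow k i + reduced_pow k.+1 i)
    = conv1 i - (-1) ^+ n *: reduced_pow n i.
  by rewrite reduced_pow_eq0 // scaler0 subr0.
elim: n => [|n IHn]; first by rewrite big_ord0 scale1r subrr.
by rewrite big_ord_recr IHn /= scalerDr addrA subrK exprS mulN1r scaleNr opprK.
Qed.

Lemma conv_antipodel i : conv antipode_basis (fun i => << i >>) i = conv1 i.
Proof.
rewrite -(telescope_antipode (leqnn _)).
(* Since [id] is [conv1 + reduced], convolving a power with [id] adds the next power to it. *)
have eK k : reduced_pow k i + reduced_pow k.+1 i = conv (reduced_pow k) (fun i => << i >>) i.
  rewrite reduced_powSr -{1}(conv1r (reduced_pow k)) /conv /lin_ext -big_split.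
  apply: eq_bigr => p _; rewrite /= -scalerDr; congr (_ *: _).
  by rewrite -(linearDE _ _ (mult_linearr _)) addrC subrK.
under eq_bigr do rewrite eK.
(* The cutoff [sz i] serves for every first factor in the coproduct of [i]. *)
transitivity (lin_ext (fun p : I * I => \sum_(k < (sz i).+1) (-1) ^+ k *:
    mul (tens (reduced_pow k p.1) << p.2 >>)) (com << i >>)).
  apply: eq_lin_ext => p /sz_com le_p.
  rewrite (@antipode_basisE (sz i)); first exact: linear_sumE (mult_linearl << p.2 >>).
  exact: leq_trans (leq_addr _ _) le_p.
rewrite /conv /lin_ext; under eq_bigr do rewrite scaler_sumr.
rewrite exchange_big; apply: eq_bigr => k _; rewrite scaler_sumr.
by apply: eq_bigr => p _; rewrite !scalerA mulrC.
Qed.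

Lemma conv_antipoder i : conv (fun i => << i >>) antipode_basis i = conv1 i.
Proof.
rewrite -(telescope_antipode (leqnn _)).
have eK k : reduced_pow k i + reduced_pow k.+1 i = conv (fun i => << i >>) (reduced_pow k) i.
  (* On this side the recursive definition of the powers already has the right form. *)
  rewrite [reduced_pow k.+1 i]/(conv reduced (reduced_pow k) i).
  rewrite -{1}(conv1l (reduced_pow k)) /conv /lin_ext -big_split.
  apply: eq_bigr => p _; rewrite /= -scalerDr; congr (_ *: _).
  by rewrite -(linearDE _ _ (mult_linearl _)) addrC subrK.
under eq_bigr do rewrite eK.
transitivity (lin_ext (fun p : I * I => \sum_(k < (sz i).+1) (-1) ^+ k *:
    mul (tens << p.1 >> (reduced_pow k p.2))) (com << i >>)).
  apply: eq_lin_ext => p /sz_com le_p.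
  rewrite (@antipode_basisE (sz i)); first exact: linear_sumE (mult_linearr << p.1 >>).
  exact: leq_trans (leq_addl _ _) le_p.
rewrite /conv /lin_ext; under eq_bigr do rewrite scaler_sumr.
rewrite exchange_big; apply: eq_bigr => k _; rewrite scaler_sumr.
by apply: eq_bigr => p _; rewrite !scalerA mulrC.
Qed.

(* Takeuchi's formula: the antipode is the alternating sum of the convolution
   powers of [id - eta cou], which is locally nilpotent. *)
Lemma connected_antipode : is_antipode mul eta com cou (lin_ext antipode_basis).
Proof.
case: algA => _ eta_lin _ _ _; case: coalgA => _ cou_lin _ _ _.
have unit_linear : linear (fun a => eta (cou a)) by exact: (linear_comp eta_lin cou_lin).
have unitU i : eta (cou << i >>) = conv1 i.
  by rewrite -[in LHS](mulr1 (cou _)) (linearZE _ (1 : R^o) eta_lin).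
split; first exact: lin_ext_linear.
- apply: linear_malg_eq => //.
    exact: (linear_comp mul_linear (linear_comp (lin_ext_linear _) com_linear)).
  move=> i; rewrite unitU -conv_antipodel (linear_lin_ext _ _ mul_linear).
  by apply: eq_lin_ext => p _ /=; rewrite lin_extU.
- apply: linear_malg_eq => //.
    exact: (linear_comp mul_linear (linear_comp (lin_ext_linear _) com_linear)).
  move=> i; rewrite unitU -conv_antipoder (linear_lin_ext _ _ mul_linear).
  by apply: eq_lin_ext => p _ /=; rewrite lin_extU.
Qed.

End Antipode.
(** * Continuous linear maps of LC-modules *)

Section LCMaps.
Local Open Scope classical_set_scope.
Local Open Scope ring_scope.
Variable R : comNzRingType.
Implicit Types I J : choiceType.

Lemma pairingE I (a : {malg R[I]}) (b : lc R I) :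
  pairing a b = lin_ext (b : I -> R^o) a.
Proof. by []. Qed.

Lemma pairing_linearl I (b : lc R I) :
  linear (fun a : {malg R[I]} => pairing a b : R^o).
Proof. exact: lin_ext_linear. Qed.

Lemma pairing_linearr I (a : {malg R[I]}) :
  linear (fun b : lc R I => pairing a b : R^o).
Proof.
move=> c b b'; rewrite /pairing scaler_sumr -big_split.
by apply: eq_bigr => i _; rewrite /= mulrDr [in LHS]mulrCA.
Qed.

Lemma pairingU I (i : I) (b : lc R I) : pairing << i >> b = b i.
Proof. exact: (@lin_extU R I R^o b i). Qed.

Lemma pairing_lc_basis I (a : {malg R[I]}) i : pairing a (lc_basis R i) = a@_i.
Proof.
rewrite /pairing /lc_basis; have [ia|/mcoeff_outdom a0] := boolP (i \in msupp a).
  by rewrite (big_fsetD1 i) //= eqxx mulr1 big1_fset ?addr0 // => k;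
     rewrite in_fsetD1 => /andP[/negPf-> _] _; rewrite mulr0.
by rewrite a0 big1 // => k _; case: eqP => [->|]; rewrite ?a0 ?mul0r ?mulr0.
Qed.

Lemma pairing_continuous I (a : {malg R[I]}) :
  continuous (pairing a : lc R I -> discrete_topology R).
Proof.
move=> b; have /cvg_sup/(_ a) : (nbhs (b : lc R I)) --> (b : lc R I) by exact: cvg_id.
move=> cvg_b; apply: cvg_trans; last first.
  exact: (@initial_continuous _ _ (pairing a : lc R I -> discrete_topology R) b).
by apply: cvg_app; exact: cvg_b.
Qed.

(** As [R] is discrete, convergence means that every pairing is eventually constant along the
    filter. *)
Lemma lc_cvg I (F : set_system (lc R I)) (b : lc R I) : Filter F ->
  (forall a : {malg R[I]}, F [set b' | pairing a b' = pairing a b]%classic) ->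
  F --> b.
Proof.
move=> FF F_pairing; apply/cvg_sup => a A /= [_ [[B _ <-] Bb sBA]].
by apply: filterS (F_pairing a) => b' /= eb; apply: sBA; rewrite /= eb.
Qed.

(* A continuous linear form vanishes on the combinations avoiding some finite
   part of the pseudobasis, for these sets form a filter tending to [0]. *)
Lemma lc_form_pairing I (f : lc R I -> R) : lc_map_to_scalars f ->
  exists a, forall b, f b = pairing a b.
Proof.
move=> [f_lin f_cont].
pose G : set_system (lc R I) := [set U | exists d : {fset I},
  forall b, {in d, b =1 fun=> 0} -> U b]%classic.
have GF : Filter G.
  split; first by exists fset0.
    move=> U V [d dU] [d' dV]; exists (d `|` d')%fset => b b0.
    by split; [apply: dU | apply: dV] => i i_d; apply: b0; rewrite in_fsetU i_d ?orbT.
  by move=> U V sUV [d dU]; exists d => b /dU /sUV.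
have G0 : G --> (0 : lc R I).
  apply: lc_cvg => a; exists (msupp a) => b b0 /=.
  by rewrite /pairing; apply: eq_big_seq => i /b0 ->; rewrite !mulr0.
(* The singleton of [f 0] is open, so continuity at 0 yields a finite [d] such that [f] takes the
   value [f 0] wherever the coefficients on [d] vanish. *)
have [d fd] : G (f @^-1` [set f 0])%classic.
  exact: G0 (f_cont 0 _ (discrete_set1 (f 0 : discrete_topology R))).
have f0 : f 0 = 0 by exact: (linear0E f_lin).
exists (\sum_(i <- d) << f (lc_basis R i) *g i >>) => b.
(* The truncation of [b] to [d]: it has the same image under [f] as [b], and it is a finite
   combination. *)
pose b1 : lc R I := \sum_(i <- d) b i *: lc_basis R i.
have b1E i : b1 i = if i \in d then b i else 0.
  rewrite /b1 fct_sumE; case: ifP => i_d.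
    rewrite (big_fsetD1 i) //= big1_fset ?addr0 => [|k].
      by rewrite [LHS]/(b i * (i == i)%:R) eqxx; exact: mulr1.
    rewrite in_fsetD1 eq_sym => /andP[/negPf kd _] _.
    by rewrite [LHS]/(b k * (i == k)%:R) kd; exact: mulr0.
  rewrite big_seq big1 // => k k_d; rewrite [LHS]/(b k * (i == k)%:R).
  by case: eqP => [e|_]; [rewrite e k_d in i_d | exact: mulr0].
have fb1 : f b = f b1.
  have -> : b = b1 + (b - b1) by rewrite addrC subrK.
  rewrite (linearDE _ _ f_lin) -[RHS]addr0; congr (_ + _); rewrite -f0; apply: fd => i i_d.
  by rewrite [LHS]/(b i - b1 i) b1E i_d; exact: subrr.
rewrite fb1 /b1 (linear_sumE _ _ _ _ f_lin) pairingE linear_sum /=.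
by apply: eq_bigr => i _; rewrite monalgUZ linearZ /= lin_extU [LHS]mulrC.
Qed.

Lemma continuous_to_lc (T : topologicalType) I (f : T -> lc R I) :
  (forall a, continuous (fun x => pairing a (f x) : discrete_topology R)) -> continuous f.
Proof.
move=> f_cont x; apply: lc_cvg => a.
exact: f_cont (discrete_set1 (pairing a (f x) : discrete_topology R)).
Qed.

(** Each coordinate of [f] is a continuous linear form, hence the pairing with some element; these
    elements are the values of [g] on the basis. *)
Lemma lc_map_adjoint I J (f : lc R I -> lc R J) : lc_map f ->
  exists2 g, linear g & adjoint f g.
Proof.
move=> [f_lin f_cont].
have gP j : exists a, forall b, f b j = pairing a b.
  have [|a fa] := @lc_form_pairing I (fun b => pairing << j >> (f b)).
    split; first exact: (linear_comp (pairing_linearr _) f_lin).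
    by move=> b; apply: (continuous_comp (f_cont b)) (@pairing_continuous _ _ _).
  by exists a => b; rewrite -fa pairingU.
have [g gE] := choice gP; exists (lin_ext g); first exact: lin_ext_linear.
move=> a b; rewrite [RHS](linear_lin_ext _ _ (pairing_linearl b)).
by apply: (@eq_lin_ext _ _ R^o (f b)) => j _; exact: gE.
Qed.

Lemma adjoint_lc_map I J (f : lc R I -> lc R J) g : adjoint f g -> lc_map f.
Proof.
move=> fg; have fE b j : f b j = pairing (g << j >>) b by rewrite -fg pairingU.
split; first by move=> c b b'; apply/funext=> j; rewrite [LHS]fE pairing_linearr -!fE.
apply: continuous_to_lc => a; have -> : (fun b => pairing a (f b)) = pairing (g a).
  by apply/funext=> b; rewrite fg.
exact: pairing_continuous.
Qed.

(** The values on the pseudobasis are the coefficients of the adjoint, and the adjoint determines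
    the map. *)
Lemma lc_map_eq I J (f f' : lc R I -> lc R J) : lc_map f -> lc_map f' ->
  (forall i, f (lc_basis R i) = f' (lc_basis R i)) -> f = f'.
Proof.
move=> /lc_map_adjoint[g _ fg] /lc_map_adjoint[g' _ fg'] ff'.
apply/funext=> b; apply/funext=> j; rewrite -!(pairingU j) fg fg'; congr pairing.
by apply/malgP=> i; rewrite -!pairing_lc_basis -fg -fg' ff'.
Qed.

Lemma lc_form_eq I (f f' : lc R I -> R) :
  lc_map_to_scalars f -> lc_map_to_scalars f' ->
  (forall i, f (lc_basis R i) = f' (lc_basis R i)) -> f = f'.
Proof.
move=> /lc_form_pairing[a fa] /lc_form_pairing[a' fa'] ff'.
apply/funext=> b; rewrite fa fa'; congr pairing.
by apply/malgP=> i; rewrite -!pairing_lc_basis -fa -fa' ff'.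
Qed.

(** Each coordinate [j] receives contributions only from the finite set [X j], so it is the pairing
    with a finite combination [g j], and the [g j] define an adjoint. *)
Lemma lc_map_extend I J (F : I -> lc R J) (X : J -> {fset I}) :
  (forall i j, F i j != 0 -> i \in X j) ->
  exists2 f : lc R I -> lc R J, lc_map f & forall i, f (lc_basis R i) = F i.
Proof.
move=> FX; pose g j : {malg R[I]} := \sum_(i <- X j) << F i j *g i >>.
exists (fun b j => pairing (g j) b).
  apply: (@adjoint_lc_map _ _ _ (lin_ext g)) => a b.
  by rewrite [RHS](linear_lin_ext _ _ (pairing_linearl b)).
move=> i; apply/funext=> j; rewrite pairing_lc_basis raddf_sum /=.
have [iX|] := boolP (i \in X j).
  rewrite (big_fsetD1 i) //= mcoeffUU big1_fset ?addr0 // => k.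
  by rewrite in_fsetD1 mcoeffU => /andP[/negPf-> _].
move=> /[dup] iX /(contraNN (FX i j)); rewrite negbK => /eqP->.
by rewrite big_seq big1 // => k kX; rewrite mcoeffU; case: eqP => // e; rewrite -e kX in iX.
Qed.

End LCMaps.
(** * Admissible pairs of subsets *)

Section Cuts.
Variable T : finType.
Implicit Types (r : rel T) (U V A B C : {set T}).

(* The index set of the coproduct of [U], for an arbitrary relation [r] in the
   role of the strict order so that [cut_dual] can reverse it. *)
Definition cut r U A B : bool := `[< [/\ A :|: B = U,
  forall x y, r x y -> x \in U -> y \in A -> x \in A,
  forall x y, r x y -> y \in U -> x \in B -> y \in B
  & forall x y, x \in A :&: B -> y \in A :&: B -> ~~ r x y] >].

Lemma cutP r U A B : reflect [/\ A :|: B = U,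
  forall x y, r x y -> x \in U -> y \in A -> x \in A,
  forall x y, r x y -> y \in U -> x \in B -> y \in B
  & forall x y, x \in A :&: B -> y \in A :&: B -> ~~ r x y] (cut r U A B).
Proof. exact: asboolP. Qed.

(** Reversing the order exchanges lower and upper sets; this halves the work in [cut_assoc]. *)
Lemma cut_dual r U A B : cut r U A B -> cut (fun x y => r y x) U B A.
Proof.
move=> /cutP[AB lA uB ac]; apply/cutP; split; first by rewrite setUC.
- by move=> x y ryx; apply: uB.
- by move=> x y ryx; apply: lA.
- by move=> x y xBA yBA; apply: ac; rewrite setIC.
Qed.

Lemma cut_assoc_imply r U A B C : cut r U (A :|: B) C -> cut r (A :|: B) A B ->
  cut r U A (B :|: C) && cut r (B :|: C) B C.
Proof.
move=> /cutP[eU lS uC acS] /cutP[_ lA uB acA].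
(* No element of [C] lies strictly below one of [A :|: B]: both would then belong to the
   intersection of the two, which is an antichain. *)
have disj x y : r x y -> x \in C -> y \in A :|: B -> False.
  move=> rxy xC yS; have yC : y \in C by apply: uC rxy _ xC; rewrite -eU inE yS.
  have xS : x \in A :|: B by apply: lS rxy _ yS; rewrite -eU inE xC orbT.
  by have := acS x y; rewrite !in_setI xS xC yS yC rxy => /(_ isT isT).
apply/andP; split; apply/cutP; split.
- by rewrite setUA.
- move=> x y rxy xU yA; have yS : y \in A :|: B by rewrite inE yA.
  exact: lA rxy (lS _ _ rxy xU yS) yA.
- move=> x y rxy yU; rewrite !in_setU => /orP[xB|xC]; last by rewrite (uC _ _ rxy yU xC) orbT.
  move: yU; rewrite -eU in_setU => /orP[yS|->]; last by rewrite orbT.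
  by rewrite (uB _ _ rxy yS xB).
- move=> x y; rewrite !inE => /andP[xA xBC] /andP[yA _]; apply/negP => rxy.
  have yS : y \in A :|: B by rewrite inE yA.
  case/orP: xBC => [xB|xC]; last exact: disj rxy xC yS.
  have yB := uB _ _ rxy yS xB.
  by have := acA x y; rewrite !in_setI xA xB yA yB rxy => /(_ isT isT).
- by [].
- move=> x y rxy xBC yB; have yS : y \in A :|: B by rewrite inE yB orbT.
  by move: xBC; rewrite in_setU => /orP[//|xC]; case: (disj _ _ rxy xC yS).
- by move=> x y rxy yBC; apply: uC rxy _; rewrite -eU -setUA inE yBC orbT.
- by move=> x y; rewrite !in_setI => /andP[xB xC] /andP[yB yC]; apply: acS;
    rewrite !inE ?xB ?yB orbT.
Qed.

(** The converse of [cut_assoc_imply] is the same implication for the reversed relation. *)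
Lemma cut_assoc r U A B C :
  cut r U (A :|: B) C && cut r (A :|: B) A B =
  cut r U A (B :|: C) && cut r (B :|: C) B C.
Proof.
apply/andP/idP => [[]|/andP[/cut_dual c1 /cut_dual c2]].
  exact: cut_assoc_imply.
rewrite [B :|: C]setUC in c1 c2.
have /andP[/cut_dual c3 /cut_dual c4] := cut_assoc_imply c1 c2.
by rewrite [A :|: B]setUC.
Qed.

(** Inclusion-exclusion for [(A :&: C) :|: (B :&: C)] and for [(A :&: B) :|: (A :&: C)]. *)
Lemma card_cut_assoc A B C :
  (#|(A :|: B) :&: C| + #|A :&: B| = #|A :&: (B :|: C)| + #|B :&: C|)%N.
Proof.
have := cardsUI (A :&: C) (B :&: C); have := cardsUI (A :&: B) (A :&: C).
rewrite -setIUl -setIUr.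
have -> : A :&: C :&: (B :&: C) = A :&: B :&: C by rewrite -setIIl.
have -> : A :&: B :&: (A :&: C) = A :&: B :&: C by rewrite -setIIr setIA.
lia.
Qed.

(** Both double sums run over the triples [(A, B, C)], as the intermediate sets are the unions
    [A :|: B] and [B :|: C]. *)
Lemma sum_cut_assoc (R : nzSemiRingType) (b : R) r U (G : {set T} -> {set T} -> {set T} -> R) :
  \sum_(SC | cut r U SC.1 SC.2) b ^+ #|SC.1 :&: SC.2| *
    \sum_(AB | cut r SC.1 AB.1 AB.2) b ^+ #|AB.1 :&: AB.2| * G AB.1 AB.2 SC.2 =
  \sum_(AV | cut r U AV.1 AV.2) b ^+ #|AV.1 :&: AV.2| *
    \sum_(BC | cut r AV.2 BC.1 BC.2) b ^+ #|BC.1 :&: BC.2| * G AV.1 BC.1 BC.2.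
Proof.
under eq_bigr do rewrite big_distrr.
under [RHS]eq_bigr do rewrite big_distrr.
rewrite !pair_big_dep /=.
rewrite (reindex_onto (fun t => ((t.1.1 :|: t.1.2, t.2), t.1)) (fun p => (p.2, p.1.2))) /=;
  last by move=> [[S C] [A B]] /= /andP[_ /cutP[<-]].
rewrite [RHS](reindex_onto (fun t => ((t.1.1, t.1.2 :|: t.2), (t.1.2, t.2)))
  (fun p => ((p.1.1, p.2.1), p.2.2))) /=;
  last by move=> [[A V] [B C]] /= /andP[_ /cutP[<-]].
apply: eq_big => [[[A B] C]|[[A B] C] _] /=; first by rewrite cut_assoc !eqxx.
by rewrite !mulrA -!exprD card_cut_assoc.
Qed.

End Cuts.
(** * Isomorphisms of labeled posets *)

Section LPosets.
Implicit Types P Q S : lposet.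

Lemma lp_class_iso P Q : lp_iso P Q -> lp_class P = lp_class Q.
Proof. by move/lp_class_eq. Qed.

Lemma lp_iso_intro P Q (phi : P -> Q) : injective phi -> (#|Q| <= #|P|)%N ->
  (forall x y : P, (phi x <= phi y)%O = (x <= y)%O) ->
  (forall s t : P, covers s t ->
    (lp_label s > lp_label t) = (lp_label (phi s) > lp_label (phi t))) ->
  lp_iso P Q.
Proof. by move=> phi_inj leQP; exists phi; split=> //; apply: inj_card_bij. Qed.

Lemma lp_iso_card P Q : lp_iso P Q -> #|P| = #|Q|.
Proof. by case=> phi [phi_bij _ _]; apply: bij_eq_card phi_bij. Qed.

Lemma lp_iso_card0 P Q : #|P| = 0%N -> #|Q| = 0%N -> lp_iso P Q.
Proof.
move=> /card0_eq P0 Q0; have noP (x : P) : False by have := P0 x; rewrite inE.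
apply: (@lp_iso_intro _ _ (fun x : P => match noP x with end)); rewrite ?Q0 //;
  by move=> x; case: (noP x).
Qed.

Lemma le_lp_suml P Q (s t : P) : (inl s <= inl t :> lp_sum P Q)%O = (s <= t)%O.
Proof. by []. Qed.
Lemma le_lp_sumr P Q (s t : Q) : (inr s <= inr t :> lp_sum P Q)%O = (s <= t)%O.
Proof. by []. Qed.
Lemma le_lp_sumlr P Q (s : P) (t : Q) : (inl s <= inr t :> lp_sum P Q)%O = false.
Proof. by []. Qed.
Lemma le_lp_sumrl P Q (s : Q) (t : P) : (inr s <= inl t :> lp_sum P Q)%O = false.
Proof. by []. Qed.

Lemma lt_lp_suml P Q (s t : P) : (inl s < inl t :> lp_sum P Q)%O = (s < t)%O.
Proof. by rewrite !lt_def. Qed.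
Lemma lt_lp_sumr P Q (s t : Q) : (inr s < inr t :> lp_sum P Q)%O = (s < t)%O.
Proof. by rewrite !lt_def. Qed.
Lemma lt_lp_sumlr P Q (s : P) (t : Q) : (inl s < inr t :> lp_sum P Q)%O = false.
Proof. by rewrite lt_def andbF. Qed.
Lemma lt_lp_sumrl P Q (s : Q) (t : P) : (inr s < inl t :> lp_sum P Q)%O = false.
Proof. by rewrite lt_def andbF. Qed.

Definition le_lp_sum := (le_lp_suml, le_lp_sumr, le_lp_sumlr, le_lp_sumrl).
Definition lt_lp_sum := (lt_lp_suml, lt_lp_sumr, lt_lp_sumlr, lt_lp_sumrl).

(** The shift is constant on the summand, because [lp_max] does not depend on its starting value. *)
Lemma lp_label_suml P Q (s t : P) :
  (lp_label (inl t : lp_sum P Q) < lp_label (inl s : lp_sum P Q)) =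
  (lp_label t < lp_label s).
Proof. by rewrite /= (lp_maxE t s) ltrD2r. Qed.

Lemma lp_label_sumr P Q (s t : Q) :
  (lp_label (inr t : lp_sum P Q) < lp_label (inr s : lp_sum P Q)) =
  (lp_label t < lp_label s).
Proof. by rewrite /= (lp_minE t s) !ltrD2r. Qed.

Definition lp_label_sum := (lp_label_suml, lp_label_sumr).

Lemma covers_suml P Q (s t : P) : covers (inl s : lp_sum P Q) (inl t) -> covers s t.
Proof.
by case; rewrite lt_lp_sum => st nu; split=> // u su; apply: (nu (inl u)); rewrite !lt_lp_sum.
Qed.

Lemma covers_sumr P Q (s t : Q) : covers (inr s : lp_sum P Q) (inr t) -> covers s t.
Proof.
by case; rewrite lt_lp_sum => st nu; split=> // u su; apply: (nu (inr u)); rewrite !lt_lp_sum.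
Qed.

Lemma card_lp_sum P Q : #|lp_sum P Q| = (#|P| + #|Q|)%N.
Proof. exact: card_sum. Qed.

Lemma lp_sum_iso P P' Q Q' : lp_iso P P' -> lp_iso Q Q' ->
  lp_iso (lp_sum P Q) (lp_sum P' Q').
Proof.
move=> PP' QQ'; have eP := lp_iso_card PP'; have eQ := lp_iso_card QQ'.
case: PP' QQ' => [f [/bij_inj f_inj f_le f_lab]] [g [/bij_inj g_inj g_le g_lab]].
apply: (@lp_iso_intro (lp_sum P Q) (lp_sum P' Q') (fun u =>
  match u with inl s => inl (f s) | inr t => inr (g t) end)).
- by move=> [s|s] [t|t] // [] => [/f_inj|/g_inj] ->.
- by rewrite !card_lp_sum eP eQ.
- by move=> [s|s] [t|t]; rewrite !le_lp_sum.
move=> [s|s] [t|t] c; try by case: c; rewrite lt_lp_sum.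
  by rewrite !lp_label_sum; apply/f_lab/covers_suml/c.
by rewrite !lp_label_sum; apply/g_lab/covers_sumr/c.
Qed.

Lemma lp_sumC P Q : lp_iso (lp_sum P Q) (lp_sum Q P).
Proof.
apply: (@lp_iso_intro (lp_sum P Q) (lp_sum Q P) (fun u =>
  match u with inl s => inr s | inr t => inl t end)).
- by move=> [s|s] [t|t] // [] ->.
- by rewrite !card_lp_sum addnC.
- by move=> [s|s] [t|t]; rewrite !le_lp_sum.
by move=> [s|s] [t|t] c; try (by case: c; rewrite lt_lp_sum); rewrite !lp_label_sum.
Qed.

Lemma lp_sumA P Q S : lp_iso (lp_sum (lp_sum P Q) S) (lp_sum P (lp_sum Q S)).
Proof.
apply: (@lp_iso_intro (lp_sum (lp_sum P Q) S) (lp_sum P (lp_sum Q S)) (fun u =>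
  match u with inl (inl s) => inl s | inl (inr t) => inr (inl t)
             | inr t => inr (inr t) end)).
- by move=> [[s|s]|s] [[t|t]|t] // [] ->.
- by rewrite !card_lp_sum addnA.
- by move=> [[s|s]|s] [[t|t]|t]; rewrite !le_lp_sum.
by move=> [[s|s]|s] [[t|t]|t] c; try (by case: c; rewrite ?lt_lp_sum); rewrite !lp_label_sum.
Qed.

Lemma lp_sum0l P Q : #|Q| = 0%N -> lp_iso (lp_sum Q P) P.
Proof.
move=> Q0; apply: lp_iso_sym.
apply: (@lp_iso_intro P (lp_sum Q P) inr); first by move=> s t [].
- by rewrite card_lp_sum Q0.
- by move=> s t; rewrite le_lp_sum.
by move=> s t _; rewrite lp_label_sum.
Qed.

Definition lp_val P (U : {set P}) (x : lp_sub U) : P := val (x : lp_sub_carrier U).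

Lemma lp_val_in P (U : {set P}) (x : lp_sub U) : lp_val x \in U.
Proof. exact: (valP (x : lp_sub_carrier U)). Qed.

Lemma lp_val_inj P (U : {set P}) : injective (@lp_val P U).
Proof. by move=> x y /val_inj. Qed.

Lemma le_lp_val P (U : {set P}) (x y : lp_sub U) : (lp_val x <= lp_val y)%O = (x <= y)%O.
Proof. by []. Qed.

Lemma lt_lp_val P (U : {set P}) (x y : lp_sub U) : (lp_val x < lp_val y)%O = (x < y)%O.
Proof. by rewrite !lt_def le_lp_val (inj_eq (@lp_val_inj _ _)). Qed.

Lemma lp_label_val P (U : {set P}) (x : lp_sub U) : lp_label (lp_val x) = lp_label x.
Proof. by []. Qed.

Definition lp_in P (U : {set P}) (x : P) (xU : x \in U) : lp_sub U :=
  exist _ x xU : lp_sub_carrier U.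

Lemma card_lp_sub P (U : {set P}) : #|lp_sub U| = #|U|.
Proof. exact: card_sig. Qed.

Lemma imset_lp_val P (U : {set P}) : @lp_val P U @: setT = U.
Proof.
apply/setP=> x; apply/imsetP/idP => [[y _ ->]|xU]; first exact: lp_val_in.
by exists (lp_in xU); rewrite ?inE.
Qed.

(** Labels are compared at covers of the subposet, which need not be covers of [P]; this form serves
    both isomorphisms and inclusions. *)
Lemma lp_sub_imset P Q (phi : P -> Q) (U : {set P}) :
  injective phi -> (forall x y : P, (phi x <= phi y)%O = (x <= y)%O) ->
  (forall s t : lp_sub U, covers s t -> (lp_label (lp_val s) > lp_label (lp_val t)) =
     (lp_label (phi (lp_val s)) > lp_label (phi (lp_val t)))) ->
  lp_iso (lp_sub U) (lp_sub (phi @: U)).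
Proof.
move=> phi_inj phi_le phi_lab.
have inU (x : lp_sub U) : phi (lp_val x) \in phi @: U by apply/imset_f/lp_val_in.
apply: (@lp_iso_intro (lp_sub U) (lp_sub (phi @: U)) (fun x => lp_in (inU x))).
- by move=> x y /(congr1 (@lp_val _ _)) /phi_inj /lp_val_inj.
- by rewrite !card_lp_sub card_imset.
- by move=> x y; rewrite -!le_lp_val phi_le.
by move=> s t /phi_lab; rewrite -!lp_label_val.
Qed.

Lemma lp_sub_sub P (U : {set P}) (V : {set lp_sub U}) :
  lp_iso (lp_sub V) (lp_sub (@lp_val P U @: V)).
Proof. by apply: lp_sub_imset => //; apply: lp_val_inj. Qed.

Lemma lp_sub_setT P : lp_iso (lp_sub [set: P]) P.
Proof.
apply: (@lp_iso_intro (lp_sub [set: P]) P (@lp_val _ _)).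
- exact: lp_val_inj.
- by rewrite card_lp_sub cardsT.
- by [].
by [].
Qed.

End LPosets.
(** The conditions of a cut concern elements of [U] only. Here [f] will be an isomorphism or the
    inclusion of an induced subposet. *)
Lemma cut_imset (T T' : finType) (r : rel T) (r' : rel T') (f : T -> T') (U A B : {set T}) :
  injective f -> (forall x y, r' (f x) (f y) = r x y) ->
  cut r' (f @: U) (f @: A) (f @: B) = cut r U A B.
Proof.
move=> f_inj fr; have mf (C : {set T}) x : (f x \in f @: C) = (x \in C) by apply: mem_imset.
apply/cutP/cutP; rewrite -imsetU -imsetI; try by move=> x y _ _; apply: f_inj.
- move=> [/imset_inj-/(_ f_inj) eU lA uB ac]; split=> // x y.
  + by rewrite -fr -!mf; apply: lA.
  + by rewrite -fr -!mf; apply: uB.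
  + by rewrite -fr -!mf; apply: ac.
- move=> [-> lA uB ac]; split=> // x y.
  + by move=> rxy /imsetP[x' x'U ex] /imsetP[y' y'A ey]; move: rxy;
      rewrite ex ey fr mf => /lA; apply.
  + by move=> rxy /imsetP[x' x'U ex] /imsetP[y' y'A ey]; move: rxy;
      rewrite ex ey fr mf => /uB; apply.
  + by move=> /imsetP[x' x'I ->] /imsetP[y' y'I ->]; rewrite fr; apply: ac.
Qed.

(** * Cuts of labeled posets and their invariance under isomorphism *)

Section LPosetCuts.
Implicit Types P Q S : lposet.

(** Cuts of the subposet [U] are given by subsets of [P], so that iterated cuts stay in one type. *)
Definition lp_cut P (U A B : {set P}) : bool := cut (fun x y : P => (x < y)%O) U A B.

Lemma lp_cutT P (A B : {set P}) :
  [&& lower_set A, upper_set B, A :|: B == [set: P] & antichain (A :&: B)] =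
  lp_cut [set: P] A B.
Proof.
apply/and4P/cutP => [[lA uB /eqP eT ac]|[eT lA uB ac]]; split=> //.
- by move=> x y xy _ yA; have /forallP/(_ x)/forallP/(_ y) := lA; rewrite xy yA.
- by move=> x y xy _ xB; have /forallP/(_ x)/forallP/(_ y) := uB; rewrite xy xB.
- by move=> x y xI yI; have /forallP/(_ x)/forallP/(_ y) := ac; rewrite xI yI.
- by apply/forallP=> x; apply/forallP=> y; apply/implyP=> /andP[xy yA]; apply: lA xy _ yA.
- by apply/forallP=> x; apply/forallP=> y; apply/implyP=> /andP[xy xB]; apply: uB xy _ xB.
- exact/eqP.
- by apply/forallP=> x; apply/forallP=> y; apply/implyP=> /andP[xI yI]; apply: ac.
Qed.

(** Covers of the induced order on a convex set are covers of [P]. Isomorphisms control labels at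
    covers only, so convexity is what lets them restrict. *)
Definition convex P (U : {set P}) : Prop :=
  forall x y z : P, x \in U -> y \in U -> (x < z)%O -> (z < y)%O -> z \in U.

Lemma lp_cut_convex P (A B : {set P}) : lp_cut [set: P] A B -> convex A /\ convex B.
Proof.
move=> /cutP[_ lA uB _]; split=> x y z xU yU xz zy.
- exact: lA zy (in_setT _) yU.
- exact: uB xz (in_setT _) xU.
Qed.

Lemma lp_sub_iso P Q (phi : P -> Q) (U : {set P}) : bijective phi ->
  (forall x y : P, (phi x <= phi y)%O = (x <= y)%O) ->
  (forall s t : P, covers s t ->
    (lp_label s > lp_label t) = (lp_label (phi s) > lp_label (phi t))) ->
  convex U -> lp_iso (lp_sub U) (lp_sub (phi @: U)).
Proof.
move=> /bij_inj phi_inj phi_le phi_lab cU; apply: lp_sub_imset => // s t [st nb].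
apply: phi_lab; split=> [|u [su ut]]; first by rewrite lt_lp_val.
have uU := cU _ _ _ (lp_val_in s) (lp_val_in t) su ut.
by apply: (nb (lp_in uU)); rewrite -!lt_lp_val.
Qed.

(* The value of the bilinear functional [F] at [Delta([P])]. *)
Definition cut_sum P (F : lpclass -> lpclass -> Zbeta) : Zbeta :=
  \sum_(ST | lp_cut [set: P] ST.1 ST.2)
    beta ^+ #|ST.1 :&: ST.2| * F (lp_class (lp_sub ST.1)) (lp_class (lp_sub ST.2)).

(** Direct images match the cuts of [P] with those of [Q], and corresponding parts are isomorphic
    since they are convex. Hence Delta is well defined on classes. *)
Lemma cut_sum_iso P Q F : lp_iso P Q -> cut_sum P F = cut_sum Q F.
Proof.
move=> [phi [phi_bij phi_le phi_lab]]; have [psi phiK psiK] := phi_bij.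
have phi_inj := bij_inj phi_bij.
have imK : cancel (fun A : {set P} => phi @: A) (fun A : {set Q} => psi @: A).
  by move=> A; rewrite -imset_comp (eq_imset _ phiK) imset_id.
have imK' : cancel (fun A : {set Q} => psi @: A) (fun A : {set P} => phi @: A).
  by move=> A; rewrite -imset_comp (eq_imset _ psiK) imset_id.
have phi_lt (x y : P) : (phi x < phi y)%O = (x < y)%O.
  by rewrite !lt_def phi_le (can_eq phiK).
rewrite [RHS](reindex (fun ST : {set P} * {set P} => (phi @: ST.1, phi @: ST.2))) /=;
  last by exists (fun ST : {set Q} * {set Q} => (psi @: ST.1, psi @: ST.2)) => -[A B] _ /=;
    rewrite ?imK ?imK'.
have eT : [set: Q] = phi @: [set: P].
  by apply/setP=> x; rewrite inE -[x]psiK imset_f.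
apply: eq_big => [[A B]|[A B] /lp_cut_convex[cA cB]] /=.
  by rewrite eT /lp_cut (cut_imset (r := fun x y : P => (x < y)%O)).
rewrite -imsetI; last by move=> x y _ _; apply: phi_inj.
rewrite card_imset //; congr (_ * F _ _); exact/lp_class_iso/lp_sub_iso.
Qed.

(** Brings the inner sums of an iterated coproduct into the form of [sum_cut_assoc]. *)
Lemma cut_sum_sub P (U : {set P}) F : cut_sum (lp_sub U) F =
  \sum_(ST | lp_cut U ST.1 ST.2)
    beta ^+ #|ST.1 :&: ST.2| * F (lp_class (lp_sub ST.1)) (lp_class (lp_sub ST.2)).
Proof.
have v_inj := @lp_val_inj P U.
rewrite [RHS](reindex_onto
  (fun ST : {set lp_sub U} * {set lp_sub U} => (@lp_val P U @: ST.1, @lp_val P U @: ST.2))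
  (fun ST : {set P} * {set P} => (@lp_val P U @^-1: ST.1, @lp_val P U @^-1: ST.2))) /=.
  apply: eq_big => [[A B]|[A B] _] /=.
    have := @cut_imset _ _ (fun x y : lp_sub U => (x < y)%O)
      (fun x y : P => (x < y)%O) _ setT A B v_inj (@lt_lp_val P U).
    rewrite imset_lp_val /lp_cut => ->.
    have imK (C : {set lp_sub U}) : @lp_val P U @^-1: (@lp_val P U @: C) = C.
      by apply/setP=> x; rewrite inE mem_imset.
    by rewrite !imK eqxx andbT.
  rewrite -imsetI; last by move=> x y _ _; apply: v_inj.
  by rewrite card_imset //; congr (_ * F _ _); apply/lp_class_iso/lp_sub_sub.
move=> [A B] /= /cutP[eU _ _ _]; have im (C : {set P}) : C \subset U ->
    @lp_val P U @: (@lp_val P U @^-1: C) = C.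
  move=> sCU; apply/setP=> x; apply/imsetP/idP => [[y + ->]|xC]; first by rewrite inE.
  by exists (lp_in (fintype.subsetP sCU x xC)); rewrite ?inE.
by rewrite !im // -eU ?subsetUl ?subsetUr.
Qed.

End LPosetCuts.

(** * Cuts of disjoint unions *)

Section LPosetSumCuts.
Implicit Types P Q S : lposet.

Definition sum_set P Q (A : {set P}) (B : {set Q}) : {set lp_sum P Q} :=
  [set u : lp_sum P Q | match u with inl s => s \in A | inr t => t \in B end].

Lemma in_sum_setl P Q (A : {set P}) (B : {set Q}) s :
  ((inl s : lp_sum P Q) \in sum_set A B) = (s \in A).
Proof. by rewrite inE. Qed.

Lemma in_sum_setr P Q (A : {set P}) (B : {set Q}) t :
  ((inr t : lp_sum P Q) \in sum_set A B) = (t \in B).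
Proof. by rewrite inE. Qed.

Definition in_sum_set := (in_sum_setl, in_sum_setr).

Lemma card_sum_set P Q (A : {set P}) (B : {set Q}) :
  #|sum_set A B| = (#|A| + #|B|)%N.
Proof.
rewrite -!sum1_card (big_sumType _ (mem (sum_set A B))) /=.
by congr addn; apply: eq_bigl => x; rewrite inE.
Qed.

Lemma sum_setI P Q (A A' : {set P}) (B B' : {set Q}) :
  sum_set A B :&: sum_set A' B' = sum_set (A :&: A') (B :&: B').
Proof. by apply/setP=> -[s|t]; rewrite in_setI !in_sum_set in_setI. Qed.

Lemma sum_setU P Q (A A' : {set P}) (B B' : {set Q}) :
  sum_set A B :|: sum_set A' B' = sum_set (A :|: A') (B :|: B').
Proof. by apply/setP=> -[s|t]; rewrite in_setU !in_sum_set in_setU. Qed.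

(** The shifts on the two sides may differ, as the extrema are taken over the subsets or over all of
    [P] and [Q]. Only comparisons within a summand matter, since no cover joins the two summands. *)
Lemma lp_sub_sum P Q (A : {set P}) (B : {set Q}) :
  lp_iso (lp_sum (lp_sub A) (lp_sub B)) (lp_sub (sum_set A B)).
Proof.
have inA (x : lp_sub A) : (inl (lp_val x) : lp_sum P Q) \in sum_set A B.
  by rewrite in_sum_set lp_val_in.
have inB (x : lp_sub B) : (inr (lp_val x) : lp_sum P Q) \in sum_set A B.
  by rewrite in_sum_set lp_val_in.
apply: (@lp_iso_intro (lp_sum (lp_sub A) (lp_sub B)) (lp_sub (sum_set A B)) (fun u =>
  match u with inl s => lp_in (inA s) | inr t => lp_in (inB t) end)).
- by move=> [s|s] [t|t] /(congr1 (@lp_val _ _)) // [] /lp_val_inj ->.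
- by rewrite card_lp_sum !card_lp_sub card_sum_set.
- by move=> [s|s] [t|t]; rewrite !le_lp_sum -!le_lp_val !le_lp_sum.
move=> [s|s] [t|t] c; try (by case: c; rewrite !lt_lp_sum).
  rewrite lp_label_sum; exact: (esym (@lp_label_suml P Q (lp_val s) (lp_val t))).
rewrite lp_label_sum; exact: (esym (@lp_label_sumr P Q (lp_val s) (lp_val t))).
Qed.

(** No element of one summand is comparable to one of the other, so each condition splits. *)
Lemma lp_cut_sum P Q (A A' : {set P}) (B B' : {set Q}) :
  lp_cut setT (sum_set A B) (sum_set A' B') = lp_cut setT A A' && lp_cut setT B B'.
Proof.
apply/cutP/andP; rewrite sum_setU sum_setI.
  move=> [/setP eT l u ac]; split; apply/cutP; split.
  - by apply/setP=> x; have := eT (inl x); rewrite in_sum_set !in_setT.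
  - by move=> x y xy _ yA; have := l (inl x) (inl y); rewrite lt_lp_sum !in_sum_set; apply.
  - by move=> x y xy _ xA; have := u (inl x) (inl y); rewrite lt_lp_sum !in_sum_set; apply.
  - by move=> x y xI yI; have := ac (inl x) (inl y); rewrite lt_lp_sum !in_sum_set; apply.
  - by apply/setP=> x; have := eT (inr x); rewrite in_sum_set !in_setT.
  - by move=> x y xy _ yA; have := l (inr x) (inr y); rewrite lt_lp_sum !in_sum_set; apply.
  - by move=> x y xy _ xA; have := u (inr x) (inr y); rewrite lt_lp_sum !in_sum_set; apply.
  - by move=> x y xI yI; have := ac (inr x) (inr y); rewrite lt_lp_sum !in_sum_set; apply.
move=> [/cutP[eT l u ac] /cutP[eT' l' u' ac']]; split.
- by apply/setP=> -[x|x]; rewrite in_sum_set ?eT ?eT' !in_setT.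
- move=> [x|x] [y|y]; rewrite lt_lp_sum // !in_sum_set => xy _.
    by apply: l xy _.
  by apply: l' xy _.
- move=> [x|x] [y|y]; rewrite lt_lp_sum // !in_sum_set => xy _.
    by apply: u xy _.
  by apply: u' xy _.
- move=> [x|x] [y|y]; rewrite lt_lp_sum // !in_sum_set; first exact: ac.
  exact: ac'.
Qed.

(** * Sum, size and coproduct on isomorphism classes *)

Definition lp_repr (c : lpclass) : lposet := projT1 (cid (lp_class_surj c)).

Lemma lp_reprK c : lp_class (lp_repr c) = c.
Proof. exact: projT2 (cid (lp_class_surj c)). Qed.

Lemma lp_repr_iso P : lp_iso (lp_repr (lp_class P)) P.
Proof. by apply/lp_class_eq; rewrite lp_reprK. Qed.

Definition class_sum (c d : lpclass) : lpclass := lp_class (lp_sum (lp_repr c) (lp_repr d)).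

Lemma class_sumE P Q : class_sum (lp_class P) (lp_class Q) = lp_class (lp_sum P Q).
Proof. by apply/lp_class_iso/lp_sum_iso; apply: lp_repr_iso. Qed.

Lemma class_sumC : commutative class_sum.
Proof. by move=> c d; apply/lp_class_iso/lp_sumC. Qed.

Lemma class_sumA c d e : class_sum (class_sum c d) e = class_sum c (class_sum d e).
Proof.
by rewrite -(lp_reprK c) -(lp_reprK d) -(lp_reprK e) !class_sumE; apply/lp_class_iso/lp_sumA.
Qed.

Definition class0 : lpclass := lp_class lp_empty.

Definition class_size (c : lpclass) : nat := #|lp_repr c|.

Lemma class_sizeE P : class_size (lp_class P) = #|P|.
Proof. exact/lp_iso_card/lp_repr_iso. Qed.

Lemma class_size0 : class_size class0 = 0%N.
Proof. by rewrite class_sizeE; exact: card_ord. Qed.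

Lemma class_size_eq0 c : (class_size c == 0%N) = (c == class0).
Proof.
apply/eqP/eqP => [c0|->]; last exact: class_size0.
rewrite -(lp_reprK c); apply/lp_class_iso/lp_iso_card0 => //; exact: card_ord.
Qed.

Lemma lp_class_eq0 P : (lp_class P == class0) = (#|P| == 0%N).
Proof. by rewrite -class_size_eq0 class_sizeE. Qed.

Lemma class_size_sum c d : class_size (class_sum c d) = (class_size c + class_size d)%N.
Proof. by rewrite class_sizeE card_lp_sum. Qed.

Lemma class_sum0l c : class_sum class0 c = c.
Proof.
by rewrite -[RHS]lp_reprK; apply/lp_class_iso/lp_sum0l/eqP; rewrite -lp_class_eq0 lp_reprK.
Qed.

Lemma class_sum0r c : class_sum c class0 = c.
Proof. by rewrite class_sumC class_sum0l. Qed.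

Definition class_cut_sum (c : lpclass) (F : lpclass -> lpclass -> Zbeta) : Zbeta :=
  cut_sum (lp_repr c) F.

Lemma class_cut_sumE P F : class_cut_sum (lp_class P) F = cut_sum P F.
Proof. exact/cut_sum_iso/lp_repr_iso. Qed.

Lemma eq_class_cut_sum c F G : (forall s t, F s t = G s t) ->
  class_cut_sum c F = class_cut_sum c G.
Proof. by move=> FG; apply: eq_bigr => ST _; rewrite FG. Qed.

(** Coassociativity of Delta, tested against a trilinear functional [F]. *)
Lemma class_cut_sum_assoc c (F : lpclass -> lpclass -> lpclass -> Zbeta) :
  class_cut_sum c (fun s d => class_cut_sum s (fun a b => F a b d)) =
  class_cut_sum c (fun a t => class_cut_sum t (fun b d => F a b d)).
Proof.
have := @sum_cut_assoc _ _ beta (fun x y : lp_repr c => (x < y)%O) setT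
  (fun A B C => F (lp_class (lp_sub A)) (lp_class (lp_sub B)) (lp_class (lp_sub C))).
rewrite /class_cut_sum /cut_sum /lp_cut => e.
apply: (etrans _ (etrans e _)); apply: eq_bigr => -[A B] _ /=; congr (_ * _).
  exact: (etrans (class_cut_sumE (lp_sub A)
    (fun a b => F a b (lp_class (lp_sub B)))) (cut_sum_sub _ _)).
exact: esym (etrans (class_cut_sumE (lp_sub B) (F (lp_class (lp_sub A)))) (cut_sum_sub _ _)).
Qed.

(** Multiplicativity of Delta: a cut of a disjoint union is a pair of cuts, and the sizes of the
    overlaps add. *)
Lemma class_cut_sum_sum c d F : class_cut_sum (class_sum c d) F =
  class_cut_sum c (fun s t => class_cut_sum d (fun s' t' =>
    F (class_sum s s') (class_sum t t'))).
Proof.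
rewrite class_cut_sumE /class_cut_sum /cut_sum.
under [RHS]eq_bigr do rewrite big_distrr /=.
rewrite pair_big_dep /=.
rewrite (reindex (fun p : ({set _} * {set _}) * ({set _} * {set _}) =>
  (sum_set p.1.1 p.2.1, sum_set p.1.2 p.2.2))) /=.
  apply: eq_big => [[[A A'] [B B']]|[[A A'] [B B']] _] /=; first exact: lp_cut_sum.
  rewrite sum_setI card_sum_set exprD -mulrA !class_sumE.
  by congr (_ * (_ * F _ _)); apply/esym/lp_class_iso/lp_sub_sum.
exists (fun p : {set lp_sum _ _} * {set lp_sum _ _} =>
  (([set x | (inl x : lp_sum _ _) \in p.1], [set x | (inl x : lp_sum _ _) \in p.2]),
   ([set x | (inr x : lp_sum _ _) \in p.1], [set x | (inr x : lp_sum _ _) \in p.2]))).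
  by move=> [[A A'] [B B']] _ /=; congr (_, _, (_, _)); apply/setP=> x; rewrite !inE.
by move=> [A B] _ /=; congr (_, _); apply/setP=> -[x|x]; rewrite !inE.
Qed.

(** The counit law: the only cut with empty lower part is [(set0, setT)]. *)
Lemma class_cut_sum0l c (f : lpclass -> Zbeta) :
  class_cut_sum c (fun s t => (s == class0)%:R * f t) = f c.
Proof.
rewrite /class_cut_sum /cut_sum (bigD1 (set0, setT)) /=; last first.
  apply/cutP; split; rewrite ?set0U // => x y; rewrite ?inE //; by rewrite set0I inE.
rewrite set0I cards0 mul1r lp_class_eq0 card_lp_sub cards0 mul1r.
rewrite (lp_class_iso (lp_sub_setT _)) lp_reprK big1 ?addr0 // => -[A B] /=.
rewrite lp_class_eq0 card_lp_sub cards_eq0.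
have [->|_ _] := eqVneq A set0; last by rewrite mul0r mulr0.
by case/andP=> /cutP[+ _ _ _]; rewrite set0U => ->; rewrite eqxx.
Qed.

Lemma class_cut_sum0r c (f : lpclass -> Zbeta) :
  class_cut_sum c (fun s t => (t == class0)%:R * f s) = f c.
Proof.
rewrite /class_cut_sum /cut_sum (bigD1 (setT, set0)) /=; last first.
  apply/cutP; split; rewrite ?setU0 // => x y; rewrite ?inE //; by rewrite setI0 inE.
rewrite setI0 cards0 mul1r lp_class_eq0 card_lp_sub cards0 mul1r.
rewrite (lp_class_iso (lp_sub_setT _)) lp_reprK big1 ?addr0 // => -[A B] /=.
rewrite lp_class_eq0 card_lp_sub cards_eq0.
have [->|_ _] := eqVneq B set0; last by rewrite mul0r mulr0.
by case/andP=> /cutP[+ _ _ _]; rewrite setU0 => ->; rewrite eqxx.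
Qed.

Lemma class_cut_sum_class0 F : class_cut_sum class0 F = F class0 class0.
Proof.
have ne (x : lp_repr class0) : False.
  by have := class_size0; move/card0_eq/(_ x); rewrite inE.
(* All subsets of an empty poset have class [class0], so the sum agrees term by term with the one in
   the counit law. *)
rewrite -[RHS](class_cut_sum0l class0 (F class0)); apply: eq_bigr => -[A B] _ /=.
have e (C : {set lp_repr class0}) : lp_class (lp_sub C) = class0.
  apply/eqP; rewrite lp_class_eq0 card_lp_sub cards_eq0; apply/eqP/setP=> x; by case: (ne x).
by rewrite !e eqxx mul1r.
Qed.

(** The parts of a cut cover the poset, so their sizes add up to at least its size. This bounds the
    classes contributing to a given coefficient of Delta. *)
Lemma class_cut_sum_size_le c (F : lpclass -> lpclass -> Zbeta) n :
  (forall s t, F s t != 0 -> (class_size s + class_size t <= n)%N) ->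
  class_cut_sum c F != 0 -> (class_size c <= n)%N.
Proof.
move=> Fn; apply: contraNT => lt_n_c; rewrite /class_cut_sum /cut_sum big1 //.
move=> [A B] /= /cutP[eT _ _ _]; apply/eqP; apply: contraNT lt_n_c => nz.
have /Fn : F (lp_class (lp_sub A)) (lp_class (lp_sub B)) != 0.
  by apply: contraNneq nz => ->; rewrite mulr0.
rewrite !class_sizeE !card_lp_sub; apply: leq_trans.
by rewrite /class_size -cardsT -eT cardsU leq_subr.
Qed.

(* A class of size [k] is determined by the order and the label comparisons,
   transported to ['I_k] along an enumeration. *)
Lemma classes_of_size_finite n :
  exists X : {fset lpclass}, forall c, (class_size c <= n)%N -> c \in X.
Proof.
pose code P : {ffun 'I_#|P| * 'I_#|P| -> bool * bool} := [ffun p =>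
  ((enum_val p.1 <= enum_val p.2 :> P)%O,
   lp_label (enum_val p.2 : P) < lp_label (enum_val p.1 : P))].
pose T := {k : 'I_n.+1 & {ffun 'I_k * 'I_k -> bool * bool}}.
(* Tables that come from no labeled poset are sent to the default [class0]. *)
pose decode (t : T) : lpclass := xget class0 [set c |
  exists P (e : #|P| = tag t), lp_class P = c /\ forall i j,
   code P (cast_ord (esym e) i, cast_ord (esym e) j) = tagged t (i, j)]%classic.
exists (seq_fset tt (codom decode)) => c; rewrite seq_fsetE => le_c.
pose P := lp_repr c; have lt_P : (#|P| < n.+1)%N by [].
apply/codomP; exists (Tagged (fun k : 'I_n.+1 => {ffun 'I_k * 'I_k -> bool * bool})
  (code P : {ffun 'I_(Ordinal lt_P) * 'I_(Ordinal lt_P) -> bool * bool})).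
rewrite /decode; case: xgetP => [d _ /= [Q [e [eQ cQ]]]|/(_ c)[]]; last first.
  by exists P, erefl; split; [exact: lp_reprK | move=> i j; rewrite !cast_ord_id].
(* [Q] has the same table as [P], so matching the two enumerations preserves the order and all label
   comparisons, in particular those at covers. *)
rewrite -eQ -(lp_reprK c) -/P; apply: lp_class_iso.
have cE i j := congr1 (fun b => b.1) (cQ i j); have lE i j := congr1 (fun b => b.2) (cQ i j).
pose phi (x : P) : Q := enum_val (cast_ord (esym e) (enum_rank x)).
apply: (@lp_iso_intro _ _ phi).
- by move=> x y /enum_val_inj /cast_ord_inj /enum_rank_inj.
- by rewrite e.
- by move=> x y; have := cE (enum_rank x) (enum_rank y); rewrite !ffunE /= !enum_rankK.
- by move=> x y _; have := lE (enum_rank x) (enum_rank y); rewrite !ffunE /= !enum_rankK.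
Qed.

End LPosetSumCuts.
(** * The Hopf algebra of labeled posets *)

Section LCHopf.

(** Turns a coefficient of a structure map into a pairing, which is easy to evaluate once its second
    argument is a pseudobasis element. *)
Lemma mcoeff_lin_ext (R : comNzRingType) (I J : choiceType) (f : I -> {malg R[J]}) a j :
  (lin_ext f a)@_j = pairing a (fun i => (f i)@_j).
Proof.
rewrite /lin_ext /pairing raddf_sum; apply: eq_bigr => i _; exact: mcoeffZ.
Qed.

Lemma mcoeff_basis (R : comNzRingType) (I : choiceType) (i j : I) :
  << i >>@_j = (i == j)%:R :> R.
Proof. exact: mcoeffU. Qed.

Lemma class_cut_suml c F (x : Zbeta) :
  class_cut_sum c F * x = class_cut_sum c (fun s t => F s t * x).
Proof. by rewrite /class_cut_sum /cut_sum big_distrl; apply: eq_bigr => ST _; rewrite /= mulrA. Qed.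

Lemma class_cut_sumr c F (x : Zbeta) :
  x * class_cut_sum c F = class_cut_sum c (fun s t => x * F s t).
Proof. by rewrite mulrC class_cut_suml; apply: eq_class_cut_sum => s t; apply: mulrC. Qed.

Lemma pairing_class_cut_sum (I : choiceType) (x : {malg Zbeta[I]}) c
    (F : lpclass -> lpclass -> lc Zbeta I) :
  pairing x (fun i => class_cut_sum c (fun s t => F s t i)) =
  class_cut_sum c (fun s t => pairing x (F s t)).
Proof.
rewrite /pairing; under eq_bigr do rewrite class_cut_sumr.
rewrite /class_cut_sum /cut_sum exchange_big; apply: eq_bigr => ST _.
by rewrite big_distrr; apply: eq_bigr.
Qed.

Lemma lc_tens_lp_basis (P Q : lposet) :
  lc_tens (lp_basis P) (lp_basis Q) = lc_basis Zbeta (lp_class P, lp_class Q).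
Proof.
by apply/funext=> -[c d]; rewrite /lc_tens /lp_basis /lc_basis xpair_eqE -mulnb natrM.
Qed.

Lemma lp_basis_repr c : lp_basis (lp_repr c) = lc_basis Zbeta c.
Proof. by rewrite /lp_basis lp_reprK. Qed.

Lemma nabla_basis nabla c d : is_nabla nabla ->
  nabla (lc_basis Zbeta (c, d)) = lc_basis Zbeta (class_sum c d).
Proof. by move=> [_ /(_ (lp_repr c) (lp_repr d))]; rewrite lc_tens_lp_basis !lp_reprK. Qed.

Lemma ex_nabla : exists! nabla, is_nabla nabla.
Proof.
have [X XP] := choice classes_of_size_finite.
(* Classes with sum [c] have size at most that of [c], so finitely many pairs contribute to the
   coefficient at [c]. *)
have [|f f_map fE] := @lc_map_extend Zbeta _ _ (fun p => lc_basis Zbeta (class_sum p.1 p.2))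
    (fun c => X (class_size c) `*` X (class_size c))%fset.
  move=> [c d] e; rewrite /lc_basis in_fsetM /=; have [->|] := eqVneq e; last by rewrite eqxx.
  by move=> _; rewrite !XP // class_size_sum ?leq_addl ?leq_addr.
have f_nabla : is_nabla f.
  by split=> // P Q; rewrite lc_tens_lp_basis fE class_sumE.
exists f; split=> // g g_nabla; apply: lc_map_eq (f_nabla.1) (g_nabla.1) _ => -[c d].
by rewrite !nabla_basis.
Qed.

Lemma delta_sumE (P : lposet) :
  \sum_(ST : {set P} * {set P} |
      [&& lower_set ST.1, upper_set ST.2, ST.1 :|: ST.2 == [set: P]
        & antichain (ST.1 :&: ST.2)])
    beta ^+ #|ST.1 :&: ST.2| *:
      lc_tens (lp_basis (lp_sub ST.1)) (lp_basis (lp_sub ST.2)) =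
  (fun p => class_cut_sum (lp_class P) (fun s t => lc_basis Zbeta (s, t) p)).
Proof.
apply/funext=> p; rewrite class_cut_sumE fct_sumE.
by apply: eq_big => [ST|ST _]; [exact: lp_cutT | rewrite lc_tens_lp_basis].
Qed.

Lemma delta_basis delta c : is_delta delta ->
  delta (lc_basis Zbeta c) = (fun p => class_cut_sum c (fun s t => lc_basis Zbeta (s, t) p)).
Proof. by move=> [_ dE]; rewrite -lp_basis_repr dE delta_sumE lp_reprK. Qed.

Lemma ex_delta : exists! delta, is_delta delta.
Proof.
have [X XP] := choice classes_of_size_finite.
(* The coefficient at [p] involves only classes whose size is at most the sum of the two sizes in
   [p]. *)
have [|f f_map fE] := @lc_map_extend Zbeta _ _
    (fun c p => class_cut_sum c (fun s t => lc_basis Zbeta (s, t) p))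
    (fun p => X (class_size p.1 + class_size p.2)%N).
  move=> c p nz; apply: XP; apply: class_cut_sum_size_le nz => s t; rewrite /lc_basis.
  by have [->|] := eqVneq p; last by rewrite eqxx.
have f_delta : is_delta f by split=> // P; rewrite fE delta_sumE.
exists f; split=> // g g_delta; apply: lc_map_eq (f_delta.1) (g_delta.1) _ => c.
by rewrite !delta_basis.
Qed.

Lemma iotaE iota r : is_iota iota -> iota r = r *: lc_basis Zbeta class0.
Proof. by move=> [[i_lin _] i1]; rewrite -[r in LHS]mulr1 (linearZE _ (1 : Zbeta^o) i_lin) i1. Qed.

Lemma ex_iota : exists! iota, is_iota iota.
Proof.
have f_iota : is_iota (fun r => r *: lc_basis Zbeta class0).
  split; last by rewrite scale1r.
  split; first by move=> c r s; rewrite scalerDl scalerA.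
  by apply/(@continuousP (discrete_topology Zbeta)) => U _; apply: discrete_open.
exists (fun r => r *: lc_basis Zbeta class0); split=> // g /iotaE gE.
by apply/funext=> r; rewrite gE.
Qed.

Lemma eps_map : lc_map_to_scalars (fun b : mLPoset => b class0).
Proof.
split; first by [].
have -> : (fun b : mLPoset => b class0) = pairing << class0 >>.
  by apply/funext=> b; rewrite pairingU.
exact: pairing_continuous.
Qed.

Lemma epsE eps : is_eps eps -> eps = (fun b : mLPoset => b class0).
Proof.
move=> [e_map eE]; apply: lc_form_eq e_map eps_map _ => c.
by rewrite -lp_basis_repr eE /lp_basis /lc_basis [class0 == _]eq_sym lp_class_eq0; case: eqP.
Qed.

Lemma ex_eps : exists! eps, is_eps eps.
Proof.
exists (fun b : mLPoset => b class0); split; last by move=> g /epsE ->.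
split; first exact: eps_map.
by move=> P; rewrite /lp_basis /lc_basis [class0 == _]eq_sym lp_class_eq0; case: eqP.
Qed.

(** * The Hopf algebra on the dual free module *)

Section Dual.
Local Notation A := {malg Zbeta[lpclass]}.
Local Notation AA := {malg Zbeta[(lpclass * lpclass)%type]}.
Variables (mul : AA -> A) (com : A -> AA).
Hypotheses (mul_linear : linear mul) (com_linear : linear com).
Hypothesis mulE : forall x c, (mul x)@_c = class_cut_sum c (fun s t => x@_(s, t)).
Hypothesis comE : forall a c d, (com a)@_(c, d) = a@_(class_sum c d).

(** [eta] and [cou] are dual to [eps] and [iota], as [mul] and [com] are to Delta and nabla. *)
Let eta (r : Zbeta) : A := r *: << class0 >>.
Let cou (a : A) : Zbeta := a@_class0.

Let mulTE a b c : (mul (tens a b))@_c = class_cut_sum c (fun s t => a@_s * b@_t).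
Proof. by rewrite mulE; apply: eq_class_cut_sum => s t; rewrite tens_coeff. Qed.

Let etaE c : (eta 1)@_c = (c == class0)%:R.
Proof. by rewrite /eta scale1r mcoeff_basis eq_sym. Qed.

(** Read on coefficients, the axioms are coassociativity and the counit laws of Delta. *)
Lemma dual_algebra : is_algebra mul eta.
Proof.
split.
- exact: mul_linear.
- by move=> c r s; rewrite /eta scalerDl scalerA.
- move=> a b c; apply/malgP=> e.
  apply: (etrans (mulTE _ _ _)); apply: (etrans _ (esym (mulTE _ _ _))).
  under eq_class_cut_sum do rewrite mulTE class_cut_suml.
  under [RHS]eq_class_cut_sum do rewrite mulTE class_cut_sumr.
  rewrite class_cut_sum_assoc; apply: eq_class_cut_sum => s t.
  by apply: eq_class_cut_sum => u v; rewrite mulrA.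
- move=> a; apply/malgP=> c; rewrite mulTE -[RHS]class_cut_sum0l.
  by apply: eq_class_cut_sum => s t; rewrite etaE.
- move=> a; apply/malgP=> c; rewrite mulTE -[RHS]class_cut_sum0r.
  by apply: eq_class_cut_sum => s t; rewrite etaE mulrC.
Qed.

(** Every coefficient on either side is a single coefficient of [a], so the axioms become the monoid
    laws of [class_sum]. *)
Lemma dual_coalgebra : is_coalgebra com cou.
Proof.
split.
- exact: com_linear.
- by move=> c a b; rewrite /cou mcoeffD mcoeffZ.
- move=> a; apply/malgP=> -[c [d e]]; rewrite !mcoeff_lin_ext.
  have -> : (fun p : lpclass * lpclass * lpclass => << (p.1.1, (p.1.2, p.2)) >>@_(c, (d, e)))
      = lc_basis Zbeta ((c, d), e).
    by apply/funext=> -[[p q] r]; rewrite mcoeff_basis /lc_basis !xpair_eqE andbA.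
  rewrite pairing_lc_basis mcoeff_lin_ext.
  have -> : (fun p : lpclass * lpclass => (tens (com << p.1 >>) << p.2 >>)@_(c, d, e))
      = lc_basis Zbeta (class_sum c d, e).
    apply/funext=> -[p q]; rewrite tens_coeff comE !mcoeff_basis /lc_basis.
    by rewrite xpair_eqE -mulnb natrM.
  have -> : (fun p : lpclass * lpclass => (tens << p.1 >> (com << p.2 >>))@_(c, (d, e)))
      = lc_basis Zbeta (c, class_sum d e).
    apply/funext=> -[p q]; rewrite tens_coeff comE !mcoeff_basis /lc_basis.
    by rewrite xpair_eqE -mulnb natrM.
  by rewrite !pairing_lc_basis !comE class_sumA.
- move=> a; apply/malgP=> c; rewrite mcoeff_lin_ext.
  have -> : (fun p : lpclass * lpclass => (cou << p.1 >> *: << p.2 >>)@_c)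
      = lc_basis Zbeta (class0, c).
    by apply/funext=> -[p q]; rewrite mcoeffZ /cou !mcoeff_basis /lc_basis xpair_eqE -mulnb natrM.
  by rewrite pairing_lc_basis comE class_sum0l.
- move=> a; apply/malgP=> c; rewrite mcoeff_lin_ext.
  have -> : (fun p : lpclass * lpclass => (cou << p.2 >> *: << p.1 >>)@_c)
      = lc_basis Zbeta (c, class0).
    apply/funext=> -[p q]; rewrite mcoeffZ /cou !mcoeff_basis /lc_basis xpair_eqE mulrC.
    by rewrite -mulnb natrM.
  by rewrite pairing_lc_basis comE class_sum0r.
Qed.

Lemma dual_bialgebra : is_bialgebra mul eta com cou.
Proof.
split; [exact: dual_algebra | exact: dual_coalgebra | split | split].
- move=> a b; apply/malgP=> -[c d]; rewrite comE mulTE class_cut_sum_sum mcoeff_lin_ext.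
  pose F s t s' t' := lc_basis Zbeta (((s, t), (s', t')) : lpclass * lpclass * (lpclass * lpclass)).
  (* The coefficient at [(c, d)] of [mul] tensored with itself is a sum of pseudobasis elements over
     pairs of cuts, matching the expansion of the left side. *)
  have -> : (fun p : lpclass * lpclass * (lpclass * lpclass) =>
       (tens (mul << p.1 >>) (mul << p.2 >>))@_(c, d)) =
     (fun p => class_cut_sum c (fun s t => class_cut_sum d (fun s' t' => F s t s' t' p))).
    apply/funext=> -[p q]; rewrite tens_coeff !mulE class_cut_suml.
    apply: eq_class_cut_sum => s t; rewrite class_cut_sumr; apply: eq_class_cut_sum => s' t'.
    by rewrite !mcoeff_basis /F /lc_basis xpair_eqE -mulnb natrM.
  rewrite (pairing_class_cut_sum _ _ (fun s t p => class_cut_sum d (fun s' t' => F s t s' t' p))).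
  apply: eq_class_cut_sum => s t; rewrite pairing_class_cut_sum; apply: eq_class_cut_sum => s' t'.
  rewrite pairing_lc_basis mcoeff_lin_ext.
  have -> : (fun p : lpclass * lpclass * (lpclass * lpclass) =>
      << ((p.1.1, p.2.1), (p.1.2, p.2.2)) >>@_((s, t), (s', t')))
      = lc_basis Zbeta ((s, s'), (t, t')).
    by apply/funext=> -[[p q] [p' q']]; rewrite mcoeff_basis /lc_basis !xpair_eqE andbACA.
  by rewrite pairing_lc_basis tens_coeff !comE.
(* A disjoint union is empty exactly when both summands are. *)
- apply/malgP=> -[c d]; rewrite comE tens_coeff !etaE -natrM mulnb.
  by rewrite -!class_size_eq0 class_size_sum addn_eq0.
- by move=> a b; rewrite /cou mulTE class_cut_sum_class0.
- by rewrite /cou etaE eqxx.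
Qed.

Lemma dual_hopf : is_hopf mul eta com cou.
Proof.
split; first exact: dual_bialgebra.
exists (lin_ext (antipode_basis mul eta com cou class_size)).
apply: (@connected_antipode _ _ _ _ _ _ dual_algebra dual_coalgebra _ class0).
- by move=> c /eqP; rewrite class_size_eq0 => /eqP.
- exact: scale1r.
- by rewrite /cou mcoeff_basis eqxx.
(* A pair in the coproduct of [c] has sum [c], so its sizes add up to that of [c]. *)
- move=> c [d e]; rewrite -mcoeff_neq0 comE mcoeff_basis /=.
  have [->|_] := eqVneq c (class_sum d e); first by rewrite class_size_sum.
  by rewrite eqxx.
Qed.

End Dual.

Lemma lc_swap_map (R : comNzRingType) (I J : choiceType) : lc_map (@lc_swap R I J).
Proof.
apply: (@adjoint_lc_map _ _ _ _ (lin_ext (fun p => << (p.2, p.1) >>))) => a b.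
rewrite [RHS](linear_lin_ext _ _ (pairing_linearl b)) [LHS]pairingE.
by apply: (@eq_lin_ext _ _ R^o) => p _ /=; rewrite pairingU.
Qed.

End LCHopf.

Theorem theorem3p4 :
  [/\ exists! nabla, is_nabla nabla,
      exists! delta, is_delta delta,
      exists! iota, is_iota iota
    & exists! eps, is_eps eps] /\
  forall (nabla : mLPoset2 -> mLPoset) (delta : mLPoset -> mLPoset2)
         (iota : Zbeta -> mLPoset) (eps : mLPoset -> Zbeta),
    is_nabla nabla -> is_delta delta -> is_iota iota -> is_eps eps ->
    is_lc_hopf nabla iota delta eps /\ lc_commutative nabla.
Proof.
split; first by split; [exact: ex_nabla|exact: ex_delta|exact: ex_iota|exact: ex_eps].
move=> nabla delta iota eps nablaP deltaP iotaP epsP; split.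
  split; first by split; [case: nablaP|case: iotaP|case: deltaP|case: epsP].
  (* The operations of the dual are obtained as adjoints; their coefficients are read off from the
     values of Delta and nabla on the pseudobasis. *)
  have [mul mul_lin mulA] := lc_map_adjoint deltaP.1.
  have [com com_lin comA] := lc_map_adjoint nablaP.1.
  exists mul, (fun r => r *: << class0 >>), com, (fun a => a@_class0).
  split; first split.
  - exact: mulA.
  - move=> r b; rewrite (epsE epsP) -[b class0]pairingU.
    exact: esym (linearZE _ _ (pairing_linearl b)).
  - exact: comA.
  - move=> a r; rewrite (iotaE _ iotaP) mulrC -pairing_lc_basis.
    exact: linearZE (pairing_linearr a).
  apply: (dual_hopf mul_lin com_lin).
  - move=> x c; rewrite -pairing_lc_basis -mulA delta_basis //.
    rewrite pairing_class_cut_sum; apply: eq_class_cut_sum => s t; exact: pairing_lc_basis.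
  - by move=> a c d; rewrite -!pairing_lc_basis -comA nabla_basis.
(* Both sides are continuous and linear, so commutativity is checked on the pseudobasis, where it is
   that of the disjoint union. *)
move=> b; suff e : (fun b => nabla (lc_swap b)) = nabla by exact: (congr1 (@^~ b) e).
have [n_lin n_cont] := nablaP.1; have [s_lin s_cont] := @lc_swap_map Zbeta lpclass lpclass.
apply: lc_map_eq nablaP.1 _.
  split; first exact: linear_comp n_lin s_lin.
  by move=> x; apply: continuous_comp (s_cont x) (n_cont _).
move=> [c d]; have -> : lc_swap (lc_basis Zbeta (c, d)) = lc_basis Zbeta (d, c).
  by apply/funext=> -[x y]; rewrite /lc_swap /lc_basis !xpair_eqE andbC.
by rewrite !nabla_basis // class_sumC.
Qed.
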